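(* Let $E$, $I$ and $\Phi\in C^1(E,\mathbb{R})$, $\Phi(u)=\frac12\|u^+\|^2-\frac12\|u^-\|^2-I(u)$, satisfy all the assumptions (E1), (E2), (I0), (I1), (I2), (I3), (S1), (S2) listed in the context. Then: (i) The Nehari–Pankov set $$\mathcal{N}_{\mathcal{P}}:=\Bigl\{u\in E\setminus(E^-\oplus E^0):\ \Phi'(u)\big|_{E^-\oplus E^0\oplus\mathbb{R}u}=0\Bigr\}$$ is non-empty and contains all non-zero critical points of $\Phi$. (ii) We have $$c:=\inf_{\mathcal{N}_{\mathcal{P}}}\Phi=\inf_{w\in E^+\setminus\{0\}}\ \sup_{E_w}\Phi>0.$$ Moreover, the value $c$ is attained by $\Phi$ on $\mathcal{N}_{\mathcal{P}}$, and every minimizer of $\Phi$ on $\mathcal{N}_{\mathcal{P}}$ is a critical point of $\Phi$. In particular, there is a ground state solution of the equation $\Phi'(u)=0$, i.e. a minimizer of $\Phi$ within the set of non-zero critical points of $\Phi$.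
   Context: $(E,\|\cdot\|)$ is a real reflexive Banach space such that: (E1) There is a topological decomposition $E=E^+\oplus E^0\oplus E^-$ into Banach spaces with associated continuous projections $P^\pm:E\to E^\pm$, $P^0:E\to E^0$; one has $\|u\|^2=\|P^+u\|^2+\|P^-u\|^2+\|P^0u\|^2$ for $u\in E$, and the map $\|\cdot\|^2$ is continuously differentiable on $E^+\oplus E^-$. Write $u^\pm=P^\pm u$, $u^0=P^0u$. (E2) The closed subspace $(E^-,\|\cdot\|)$ is uniformly convex. The functional $I:E\to\mathbb{R}$ satisfies: (I0) $I\in C^1(E)$ is nonnegative, $I(0)=0$, $I'(0)=0$, $I(u)>0$ for $u\in E^0\setminus\{0\}$. For each $u\in E\setminus\{0\}$, the function $t\mapsto I(tu)/t^2$ is nondecreasing on $(0,\infty)$, $\limsup_{t\to0}I(tu)/t^2<\|u\|^2/2$, and $\lim_{t\to+\infty}I(tu)/t^2=+\infty$ if $I(u)\ne0$ and $u^+\neq0$. (I1) For every $\varepsilon>0$ there is $\kappa_\varepsilon>0$ with $I(\phi+\psi)\le\varepsilon+\kappa_\varepsilon(I(\phi)+I(\psi))$ for all $\phi,\psi\in E$. (I2) For every $u\in E$ and every sequence $(w_n)$ in $E^+$ with $w_n\rightharpoonup w$ weakly in $E^+$ one has $I(u+w_n)\to I(u+w)$. (I3) If $(u_n)$ is a sequence in $E$ with $u_n\rightharpoonup u$ weakly and $u_n^+\to u^+$ strongly, then $I(u)\le\liminf_{n\to\infty}I(u_n)$. If, in addition, $u_n^-\to u^-$ strongly and equality holds in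 this inequality, then $u_n^0\to u^0$ strongly after passing to a subsequence. For $w\in E^+\setminus\{0\}$ put $E_w:=\mathbb{R}^+w+E^0+E^-$ with $\mathbb{R}^+=(0,\infty)$. (S1) For each $w\in E^+\setminus\{0\}$ there is at most one $u\in E_w$ with $\Phi'(u)\equiv0$ on $\mathbb{R}w\oplus E^0\oplus E^-$; moreover, if such $u$ exists, it is a global maximizer of $\Phi$ on $E_w$. (S2) $\sup_{E_w}\Phi<\infty$ for at least one $w\in E^+\setminus\{0\}$. *)

(* Defs.v *)
From mathcomp Require Import all_boot all_order all_algebra.
From mathcomp Require Import all_classical all_reals all_analysis.

Set Implicit Arguments.
Unset Strict Implicit.
Unset Printing Implicit Defensive.

Import Order.TTheory GRing.Theory Num.Theory.
Import numFieldNormedType.Exports.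

Local Open Scope classical_set_scope.
Local Open Scope ring_scope.

(* A linear subspace of a normed space E is a set V : set E carrying the
   induced norm; notions "on V" only look at arguments lying in V, and V = setT
   gives the corresponding notion on E itself. *)

Section Subspaces.
Context {R : realType} {E : normedModType R}.
Implicit Types (V W : set E) (f : E -> R).

Definition closed_subspace V : Prop :=
  [/\ V 0, (forall (a : R) x y, V x -> V y -> V (a *: x + y)) & closed V].

Definition set_add V W : set E := [set x + y | x in V & y in W].

Definition line (u : E) : set E := [set t *: u | t in [set: R]].

(* Functions E -> R whose restriction to V belongs to the topological dual of V;
   the values outside V are irrelevant. *)
Definition dual V : set (E -> R) :=
  [set f | (forall (a : R) x y, V x -> V y -> f (a *: x + y) = a * f x + f y)
           /\ {within V, continuous f}].

(* [sup] is the supremum in R: this is the operator norm when f is in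
   [dual V], the set of values being then bounded. *)
Definition dual_norm V f : R :=
  sup [set `|f x| | x in [set x | V x /\ `|x| <= 1]].

Definition weak_cvg V (u : nat -> E) (l : E) : Prop :=
  forall f, dual V f -> f (u n) @[n --> \oo] --> f l.

Definition uniformly_convex V : Prop :=
  forall eps : R, 0 < eps -> exists2 delta : R, 0 < delta &
    forall x y, V x -> V y -> `|x| = 1 -> `|y| = 1 -> eps <= `|x - y| ->
      `|2^-1 *: (x + y)| <= 1 - delta.

(* f restricted to V is continuously Frechet differentiable as a function on the
   normed space V, with derivative D : V -> V^*. *)
Definition C1_on V f : Prop :=
  exists D : E -> E -> R, forall u, V u ->
    [/\ dual V (D u),
        forall eps : R, 0 < eps -> \forall h \near nbhs (0 : E),
          V h -> `|f (u + h) - f u - D u h| <= eps * `|h|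
      & dual_norm V (fun h => D v h - D u h) @[v --> within V (nbhs u)] --> 0].

Definition C1 f : Prop :=
  (forall u, differentiable f u) /\
  (forall u, dual_norm setT (fun h => 'd f v h - 'd f u h) @[v --> u] --> 0).

Definition diff_zero_on f (u : E) V : Prop := forall h, V h -> 'd f u h = 0.

Definition critical f (u : E) : Prop := diff_zero_on f u setT.

End Subspaces.

(* Surjectivity of the canonical embedding of E into its bidual. *)
Definition reflexive_space (R : realType) (E : normedModType R) : Prop :=
  forall F : (E -> R) -> R,
    (forall (a : R) f g, dual setT f -> dual setT g ->
       F (fun x => a * f x + g x) = a * F f + F g) ->
    (exists C : R, forall f, dual setT f -> `|F f| <= C * dual_norm setT f) ->
    exists x : E, forall f, dual setT f -> F f = f x.

(* E is the direct sum of the closed subspaces Ep, E0, Em, and Pp, P0, Pm are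
   the associated projections, seen as maps from E to E. *)
Record topological_decomposition (R : realType) (E : normedModType R)
    (Ep E0 Em : set E) (Pp P0 Pm : {linear E -> E}) : Prop := {
  decomp_closed :
    [/\ closed_subspace Ep, closed_subspace E0 & closed_subspace Em];
  decomp_direct : forall x y z, Ep x -> E0 y -> Em z -> x + y + z = 0 ->
    [/\ x = 0, y = 0 & z = 0];
  decomp_proj : forall u, [/\ Ep (Pp u), E0 (P0 u) & Em (Pm u)];
  decomp_sum : forall u, u = Pp u + P0 u + Pm u;
  decomp_continuous : [/\ continuous Pp, continuous P0 & continuous Pm]
}.

Section NehariPankov.
Context {R : realType} {E : normedModType R}.
Variables (E0 Em : set E).

Definition half_space (w : E) : set E :=
  set_add (set_add [set t *: w | t in [set t : R | 0 < t]] E0) Em.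

Definition nehari_pankov (Phi : E -> R) : set E :=
  [set u | ~ set_add Em E0 u /\
           diff_zero_on Phi u (set_add (set_add Em E0) (line u))].

End NehariPankov.

(* Main.v *)
Require Import Defs.
From mathcomp Require Import all_boot all_order all_algebra.
From mathcomp Require Import all_classical all_reals all_analysis.
From mathcomp Require Import lra ring.

Set Implicit Arguments.
Unset Strict Implicit.
Unset Printing Implicit Defensive.

Import Order.TTheory GRing.Theory Num.Theory.
Import numFieldNormedType.Exports.

Local Open Scope classical_set_scope.
Local Open Scope ring_scope.

(** The half-spaces E_w reduce the theorem to a minimax problem.  By S1, a point u
    of the Nehari-Pankov set is the unique maximizer of Phi on E_w for w = u+;
    conversely a maximizer of Phi on some E_w lies in the Nehari-Pankov set,
    because E_w is invariant under small shifts along R w + E0 + E-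
    ([maximizer_diff]).  Hence everything follows from the study of
    c = inf_w sup_(E_w) Phi: it has to be attained by one w and one point of E_w
    ([minimal_ray_attained]), and a maximizer at level c has to be critical in the
    directions of E+ as well ([minimizer_critical]).

    Compactness rests on three facts.  Since the space is reflexive, bounded
    sequences have weakly convergent subsequences ([bounded_weak_subsequence]).
    Since the norm of E- and I are weakly lower semicontinuous, Phi is upper
    semicontinuous along weakly convergent sequences whose E+ parts converge
    strongly ([Phi_usc]).  Finally, a sequence on which Phi stays nonnegative, taken
    from half-spaces E_(w_n) with w_n converging to some w <> 0 such that Phi is
    bounded above on E_w, is bounded ([bounded_of_Phi_ge0]).  For the last one,
    suppose that u_n blows up and let v be the weak limit of u_n / |u_n|.  As
    I(tu)/t^2 is nondecreasing, Phi >= 0 passes from u_n to all shorter multiples of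
    it, so Phi(Tv) >= 0 for every T > 0.  This forces v = 0
    ([asymptotic_direction_trivial]): if I were nonzero somewhere on the half-line
    of v, its superquadratic growth would make Phi(Tv) negative; if I vanishes on
    this half-line, I1 bounds I(Tv + w) independently of T while the quadratic part
    of Phi(Tv + w) grows linearly in T, against the upper bound on E_w.  But then
    Phi(v_n) >= 0 = Phi(0) turns the weak convergence of v_n = u_n / |u_n| to 0 into
    strong convergence ([strong_limit_of_max]), and |v_n| = 1 is contradicted.

    To reach c, take unit vectors w_n in E+ with sup_(E_(w_n)) Phi -> c and a weak
    limit w.  By I2, Phi at a point tw + z of E_w is at most the limit of Phi at the
    points t w_n + z, hence at most c; and w = 0 is impossible, as t^2 / 2 <= c would
    follow for all t.  A maximizing sequence on E_w then converges weakly to a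
    maximizer, and c > 0 because Phi is positive at small multiples of w.

    To see that a minimizer u is critical, suppose Phi'(u)h < 0 with h in E+.  Tilt
    the half-space towards h, w_n = u+ + tau_n h, and choose y_n in E_(w_n) with
    Phi(y_n) > c - tau_n^2, which is possible because sup_(E_(w_n)) Phi >= c.  A
    subsequence converges strongly, to a maximizer of Phi on E_(u+), that is, to u.
    Removing the component of y_n along h leads back to E_(u+), where Phi <= c; but
    this removal raises Phi by an amount of order tau_n, more than tau_n^2. *)

(** * Hahn-Banach theorem *)

Lemma inf_le_image (R : realType) (T : Type) (A : set T) (f : T -> R) (m : R) a :
  (forall x, A x -> m <= f x) -> A a -> inf [set f x | x in A] <= f a.
Proof.
by move=> mf Aa; apply: ge_inf; [exists m => _ [x Ax <-]; exact: mf | exists a].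
Qed.

Lemma inf_image_lt (R : realType) (T : Type) (A : set T) (f : T -> R) (m e : R) :
  (forall x, A x -> m <= f x) -> A !=set0 -> 0 < e ->
  exists2 a, A a & f a < inf [set f x | x in A] + e.
Proof.
move=> mf [a Aa] e0.
have [|_ [x Ax <-] fx] := inf_adherent e0 (_ : has_inf [set f x | x in A]).
  by split; [exists (f a), a | exists m => _ [x Ax <-]; exact: mf].
by exists x.
Qed.

Section HahnBanach.
Context {R : realType} {E : lmodType R}.
Implicit Types (p q : E -> R) (x y z : E).

Definition sublinear p :=
  (forall x y, p (x + y) <= p x + p y) /\
  (forall t x, 0 < t -> p (t *: x) <= t * p x).

Lemma sublinearZ p t x : sublinear p -> 0 <= t -> p (t *: x) = t * p x.
Proof.
move=> [_ pZ]; have pos s y : 0 < s -> p (s *: y) = s * p y.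
  move=> s0; apply/eqP; rewrite eq_le pZ//= -ler_pdivlMl//.
  by rewrite -{1}(scalerK (lt0r_neq0 s0) y) pZ// invr_gt0.
rewrite le_eqVlt => /predU1P[<-|/pos->//]; rewrite scale0r mul0r.
by have := pos 2 0 (ltr0n _ 2); rewrite scaler0; lra.
Qed.

Lemma sublinear0 p : sublinear p -> p 0 = 0.
Proof. by move=> sp; rewrite -(scale0r 0) sublinearZ// mul0r. Qed.

Lemma sublinearN p x : sublinear p -> - p (- x) <= p x.
Proof.
move=> sp; have [pD _] := sp; have := pD x (- x).
by rewrite subrr sublinear0//; lra.
Qed.

Lemma sublinearB p x y : sublinear p -> p x - p y <= p (x - y).
Proof. by move=> [pD _]; have := pD (x - y) y; rewrite subrK; lra. Qed.

(** The largest sublinear functional below p whose value at - z is at most - p z: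
    a linear functional below p takes the value p z at z exactly when it lies below
    [tilt p z]. *)
Definition tilt p z x : R := inf [set p (x + t *: z) - t * p z | t in [set t | 0 <= t]].

Lemma tilt_lb p z x : sublinear p ->
  forall t, 0 <= t -> - p (- x) <= p (x + t *: z) - t * p z.
Proof.
move=> sp t t0; have := sublinearB (t *: z) (- x) sp.
by rewrite opprK addrC sublinearZ// [_ + x]addrC; lra.
Qed.

Lemma tilt_le p z x t : sublinear p -> 0 <= t ->
  tilt p z x <= p (x + t *: z) - t * p z.
Proof.
move=> sp t0; exact: (@inf_le_image _ _ _ (fun t => _ - t * _) _ _ (tilt_lb z x sp)).
Qed.

Lemma tilt_lt p z x e : sublinear p -> 0 < e ->
  exists2 t, 0 <= t & p (x + t *: z) - t * p z < tilt p z x + e.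
Proof.
move=> sp; apply: (@inf_image_lt _ _ _ (fun t => _ - t * _) _ _ (tilt_lb z x sp)).
by exists 0 => /=.
Qed.

Lemma sublinear_tilt p z : sublinear p -> sublinear (tilt p z).
Proof.
move=> sp; have [pD _] := sp; split=> [x y|t x t0]; apply/ler_addgt0Pr => e e0.
  have e20 : 0 < e / 2 by rewrite divr_gt0.
  have [s s0 sx] := tilt_lt z x sp e20; have [t t0 ty] := tilt_lt z y sp e20.
  have := tilt_le z (x + y) sp (addr_ge0 s0 t0).
  have := pD (x + s *: z) (y + t *: z).
  by rewrite addrACA -scalerDl; lra.
have [s s0 sx] := tilt_lt z x sp (divr_gt0 e0 t0).
have := tilt_le z (t *: x) sp (mulr_ge0 (ltW t0) s0).
rewrite -scalerA -scalerDr (sublinearZ _ sp (ltW t0)) => /le_trans; apply.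
by move: sx; rewrite -(ltr_pM2l t0) !mulrDr [t * (e / t)]mulrC divfK ?gt_eqF//; lra.
Qed.

Lemma tilt_le_self p z x : sublinear p -> tilt p z x <= p x.
Proof.
by move=> sp; have := tilt_le z x sp (lexx 0); rewrite scale0r addr0 mul0r subr0.
Qed.

(** Zorn's lemma for the reversed pointwise order.  The bound q x >= - p (- x),
    common to all sublinear q below p, keeps the infimum of a chain finite. *)
Lemma minimal_sublinear p : sublinear p -> exists q,
  [/\ sublinear q, forall x, q x <= p x &
      forall r, sublinear r -> (forall x, r x <= q x) -> r = q].
Proof.
move=> sp; pose T := {q : E -> R | sublinear q /\ forall x, q x <= p x}.
pose below (s t : T) := `[< forall x, sval t x <= sval s x >].
have [|r s t /asboolP rs /asboolP st||A Atot|[q [sq qp]] qmin] := @Zorn T below.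
- by move=> s; apply/asboolP.
- by apply/asboolP => x; exact: le_trans (st x) (rs x).
- move=> [s sP] [t tP] /asboolP/= st /asboolP/= ts; apply: eq_exist => /=.
  by apply/funext => x; apply/eqP; rewrite eq_le ts st.
- have [[a Aa]|A0] := pselect (A !=set0); last first.
    by exists (exist _ p (conj sp (fun x => lexx _))) => s As; case: A0; exists s.
  pose q x := inf [set sval s x | s in A].
  have lb x s : A s -> - p (- x) <= sval s x.
    case: s => s [ss sp'] _ /=; apply: le_trans (sublinearN x ss).
    by rewrite lerN2.
  have qle x s : A s -> q x <= sval s x.
    exact: (@inf_le_image _ _ _ (fun s : T => sval s x) _ _ (lb x)).
  have qlt x e : 0 < e -> exists2 s, A s & sval s x < q x + e.
    by apply: (@inf_image_lt _ _ _ (fun s : T => sval s x) _ _ (lb x)); exists a.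
  have sq : sublinear q.
    split=> [x y|t x t0]; apply/ler_addgt0Pr => e e0.
      have e20 : 0 < e / 2 by rewrite divr_gt0.
      have [s As sx] := qlt x _ e20; have [t At ty] := qlt y _ e20.
      have [/asboolP st|/asboolP ts] := Atot _ _ As At.
        have := qle (x + y) _ At; have [tD _] := (svalP t).1.
        by have := tD x y; have := st x; lra.
      have := qle (x + y) _ As; have [sD _] := (svalP s).1.
      by have := sD x y; have := ts y; lra.
    have [s As sx] := qlt x _ (divr_gt0 e0 t0).
    have := qle (t *: x) _ As; rewrite (sublinearZ _ (svalP s).1 (ltW t0)).
    move=> /le_trans; apply.
    by move: sx; rewrite -(ltr_pM2l t0) mulrDr [t * (e / t)]mulrC divfK ?gt_eqF//; lra.
  have qp x : q x <= p x by apply: le_trans (qle x _ Aa) _; exact: (svalP a).2.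
  by exists (exist _ q (conj sq qp)) => s As; apply/asboolP => x; exact: qle.
exists q; split=> // r sr rq.
have rp x : r x <= p x by exact: le_trans (rq x) (qp x).
by apply: (congr1 sval (qmin (exist _ r (conj sr rp)) _)); apply/asboolP.
Qed.

(** A minimal sublinear f is linear: [tilt f x] is sublinear and below f, hence equal
    to f, and it is at most - f x at - x; so f is odd, and an odd sublinear functional
    is additive.  Starting the minimization at [tilt p z] instead of p yields
    f z = p z. *)
Theorem hahn_banach p z : sublinear p -> exists f : E -> R,
  [/\ forall (a : R) x y, f (a *: x + y) = a * f x + f y,
      forall x, f x <= p x & f z = p z].
Proof.
move=> sp; have [f [sf fp fmin]] := minimal_sublinear (sublinear_tilt z sp).
have oddf x : f (- x) = - f x.
  have ff : tilt f x = f.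
    by apply: fmin => [|y]; [exact: sublinear_tilt | exact: tilt_le_self].
  have := tilt_le x (- x) sf ler01; rewrite ff scale1r addNr sublinear0// mul1r.
  by have := sublinearN (- x) sf; rewrite opprK; lra.
have fle x : f x <= p x by apply: le_trans (fp x) (tilt_le_self _ _ sp).
have addf x y : f (x + y) = f x + f y.
  have [fD _] := sf; apply/eqP; rewrite eq_le fD/=.
  by have := fD (x + y) (- y); rewrite addrK oddf; lra.
exists f; split=> // [a x y|]; last first.
  have := tilt_le z (- z) sp ler01; rewrite scale1r addNr sublinear0// mul1r.
  by have := fp (- z); rewrite oddf; have := fle z; lra.
rewrite addf; congr (_ + _); have [a0|a0] := leP 0 a; first exact: sublinearZ.
have Na0 : 0 <= - a by rewrite oppr_ge0 ltW.
by rewrite -{1}[a]opprK scaleNr oddf (sublinearZ _ sf Na0) mulNr opprK.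
Qed.

End HahnBanach.

(** * Continuous linear functionals *)

Section DualSpace.
Context {R : realType} {E : normedModType R}.
Implicit Types (f : E -> R) (x y : E).

Lemma dualP f : dual setT f <->
  (forall (a : R) x y, f (a *: x + y) = a * f x + f y) /\ continuous f.
Proof.
by rewrite /dual /= -continuous_subspace_setT; split=> -[fl fc]; split=> // *; exact: fl.
Qed.

Lemma dual_of_bound f C : (forall (a : R) x y, f (a *: x + y) = a * f x + f y) ->
  (forall x, f x <= C * `|x|) -> dual setT f.
Proof.
move=> fl fC; apply/dualP; split=> // x; apply/cvgrPdist_lt => e e0.
have fB y z : f (y - z) = f y - f z by rewrite addrC -scaleN1r fl mulN1r addrC.
have absf y : `|f y| <= C * `|y|.
  rewrite ler_norml fC andbT lerNl -[leLHS](_ : f (- y) = _).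
    by rewrite -(normrN y).
  by have := fB y y; have := fB 0 y; rewrite subrr sub0r; lra.
have C0 : 0 < `|C| + 1 by rewrite ltr_wpDl.
near=> y; rewrite -fB; apply: le_lt_trans (absf _) _.
have : `|x - y| < e / (`|C| + 1) by near: y; apply: cvgr_dist_lt; rewrite ?divr_gt0.
rewrite ltr_pdivlMr// mulrC; apply: le_lt_trans; rewrite ler_wpM2r//.
by rewrite (le_trans (ler_norm _))// lerDl.
Unshelve. all: by end_near. Qed.

Lemma dual0 f : dual setT f -> f 0 = 0.
Proof. by move=> /dualP[fl _]; have := fl 1 0 0; rewrite scaler0 addr0; lra. Qed.

Lemma dualZ f (a : R) x : dual setT f -> f (a *: x) = a * f x.
Proof.
by move=> df; have /dualP[fl _] := df; rewrite -[_ *: _]addr0 fl dual0// addr0.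
Qed.

Lemma dualD f x y : dual setT f -> f (x + y) = f x + f y.
Proof. by move=> /dualP[fl _]; rewrite -{1}[x]scale1r fl mul1r. Qed.

Lemma dualB f x y : dual setT f -> f (x - y) = f x - f y.
Proof. by move=> df; rewrite dualD// -scaleN1r dualZ// mulN1r. Qed.

Lemma dual_bounded f : dual setT f -> exists2 C : R, 0 < C & forall x, `|f x| <= C * `|x|.
Proof.
move=> df; have /dualP[_ /(_ 0)/cvgrPdist_lt/(_ 1 ltr01)] := df.
rewrite dual0// => /nbhs_norm0P[d /= d0 fd].
exists (2 / d); first by rewrite divr_gt0.
move=> x; have [->|x0] := eqVneq x 0; first by rewrite dual0// !normr0 mulr0.
have nx : 0 < `|x| by rewrite normr_gt0.
have c0 : 0 < d / 2 / `|x| by rewrite !divr_gt0.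
have := fd (d / 2 / `|x| *: x); rewrite /= normrZ (gtr0_norm c0) divfK ?gt_eqF//.
rewrite ltr_pdivrMr// ltr_pMr// ltr1n => /(_ isT).
rewrite sub0r normrN dualZ// normrM (gtr0_norm c0) => /ltW.
rewrite -ler_pdivlMl// mulr1 => /le_trans; apply.
by rewrite !invfM !invrK [_^-1 * 2]mulrC.
Qed.

Lemma dual_norm_ub f x : dual setT f -> `|x| <= 1 -> `|f x| <= dual_norm setT f.
Proof.
move=> df x1; have [C C0 fC] := dual_bounded df; apply: ub_le_sup; last by exists x.
by exists C => _ [y [_ y1] <-]; apply: le_trans (fC y) _; rewrite ger_pMr.
Qed.

Lemma dual_norm_ge0 f : dual setT f -> 0 <= dual_norm setT f.
Proof.
by move=> df; apply: le_trans (normr_ge0 (f 0)) (dual_norm_ub df _); rewrite normr0.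
Qed.

Lemma le_dual_norm f x : dual setT f -> `|f x| <= dual_norm setT f * `|x|.
Proof.
move=> df; have [->|x0] := eqVneq x 0; first by rewrite dual0// !normr0 mulr0.
have nx : 0 < `|x| by rewrite normr_gt0.
have := @dual_norm_ub f (`|x|^-1 *: x) df.
rewrite normrZ dualZ// normrM ger0_norm ?invr_ge0// mulVf ?gt_eqF// => /(_ (lexx _)).
by rewrite ler_pdivrMl// mulrC.
Qed.

Lemma norming_functional x : exists f,
  [/\ dual setT f, forall y, f y <= `|y| & f x = `|x|].
Proof.
have [|f [fl fle fx]] := @hahn_banach R E (fun y => `|y|) x.
  by split=> [y z|t y t0]; rewrite ?ler_normD// normrZ gtr0_norm.
by exists f; split=> //; apply: (dual_of_bound (C := 1)) => // y; rewrite mul1r.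
Qed.

(** Hahn-Banach for the distance to D.  Only real multiples of points of D have to be
    approximable in D, so that D may be countable. *)
Lemma distance_functional (D : set E) x (e : R) : 0 < e -> D 0 ->
  (forall y z, D y -> D z -> D (y + z)) ->
  (forall (a d : R) y, 0 < d -> D y -> exists2 z, D z & `|a *: y - z| < d) ->
  (forall y, D y -> e <= `|x - y|) ->
  exists f, [/\ dual setT f, forall y, D y -> f y <= 0 & e <= f x].
Proof.
move=> e0 D0 DD DZ De; pose p y := inf [set `|y - z| | z in D].
have ple y z : D z -> p y <= `|y - z|.
  by apply: (@inf_le_image _ _ D (fun z => `|y - z|) 0).
have plt y d : 0 < d -> exists2 z, D z & `|y - z| < p y + d.
  by move=> d0; apply: (@inf_image_lt _ _ D (fun z => `|y - z|) 0) => //; exists 0.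
have sp : sublinear p.
  split=> [y z|t y t0]; apply/ler_addgt0Pr => d d0.
    have d20 : 0 < d / 2 by rewrite divr_gt0.
    have [v Dv yv] := plt y _ d20; have [w Dw zw] := plt z _ d20.
    have := ple (y + z) _ (DD _ _ Dv Dw).
    by have := ler_normD (y - v) (z - w); rewrite addrACA -opprD; lra.
  have d20 : 0 < d / 2 by rewrite divr_gt0.
  have [v Dv yv] := plt y _ (divr_gt0 d20 t0).
  have [w Dw tvw] := DZ t _ _ d20 Dv.
  have := ple (t *: y) _ Dw; have := ler_normD (t *: (y - v)) (t *: v - w).
  rewrite {1}scalerBr addrA subrK normrZ gtr0_norm//.
  move: yv; rewrite -(ltr_pM2l t0) mulrDr [t * (d / 2 / t)]mulrC divfK ?gt_eqF//.
  by lra.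
have [f [fl fp fx]] := hahn_banach x sp; exists f; split.
- apply: (dual_of_bound (C := 1)) => // y; rewrite mul1r (le_trans (fp y))//.
  by have := ple y _ D0; rewrite subr0.
- by move=> y Dy; apply: le_trans (fp y) _; have := ple y _ Dy; rewrite subrr normr0.
- rewrite fx; apply: lb_le_inf; first by exists `|x - 0|, 0.
  by move=> _ [z Dz <-]; exact: De.
Qed.

End DualSpace.

(** * Weak sequential compactness of bounded sequences *)

Section WeakCompactness.
Context {R : realType} {E : normedModType R}.
Implicit Types (u : nat -> E) (f : E -> R) (x : E).

Lemma bounded_cvg_ultra (U : set_system nat) (a : nat -> R) (B : R) :
  UltraFilter U -> (\forall n \near U, `|a n| <= B) -> exists l : R, a n @[n --> U] --> l.
Proof.
move=> UU aB; have PU : ProperFilter U by exact: ultra_proper.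
have [|l [_ clul]] := @segment_compact R (- B) B (a @ U) _.
  by apply: filterS aB => n /=; rewrite in_itv/= ler_norml.
exists l => N Nl; have [//|UN] := in_ultra_setVsetC (a @^-1` N) UU.
by have [y []] := clul (~` N) N UN Nl.
Qed.

(** The limits of f (u n) along U define a bounded linear functional of f, which
    reflexivity represents by a point. *)
Lemma weak_limit_ultra (U : set_system nat) u (B : R) :
  reflexive_space E -> UltraFilter U -> (\forall n \near U, `|u n| <= B) ->
  exists x, forall f, dual setT f -> f (u n) @[n --> U] --> f x.
Proof.
move=> refl UU uB; have PU : ProperFilter U by exact: ultra_proper.
have fle f n : dual setT f -> `|u n| <= B -> `|f (u n)| <= B * dual_norm setT f.
  move=> df un; apply: le_trans (le_dual_norm _ df) _.
  by rewrite mulrC ler_wpM2r// dual_norm_ge0.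
have cvf f : dual setT f -> f (u n) @[n --> U] --> lim (f (u n) @[n --> U]).
  move=> df; have [|l fl] := @bounded_cvg_ultra U (f \o u) (B * dual_norm setT f) UU.
    by apply: filterS uB => n; exact: fle.
  by apply/cvg_ex; exists l.
have [a f g df dg||x xE] := refl (fun f => lim (f (u n) @[n --> U])).
- by apply/cvg_lim => //; apply: cvgD (cvf _ dg); apply: cvgMl_tmp (cvf _ df).
- exists B => f df; apply: (cvgr_to_le (cvg_norm (cvf _ df))).
  by apply: filterS uB => n; exact: fle.
- by exists x => f df; rewrite -xE//; exact: cvf.
Qed.

(** The combinations with rational coefficients form a countable set, dense in the
    span of u: countably many functionals suffice to norm all of them. *)
Fixpoint rat_comb u (s : seq rat) : E :=
  if s is q :: s' then ratr q *: u 0%N + rat_comb (u \o succn) s' else 0.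

Lemma rat_combD u s t : exists r, rat_comb u r = rat_comb u s + rat_comb u t.
Proof.
elim: s u t => [|q s IH] u t; first by exists t; rewrite add0r.
case: t => [|p t]; first by exists (q :: s); rewrite addr0.
have [r rE] := IH (u \o succn) t; exists (q + p :: r).
by rewrite /= rE rmorphD/= scalerDl addrACA.
Qed.

Lemma rat_combZ u (q : rat) s : rat_comb u (map ( *%R q) s) = ratr q *: rat_comb u s.
Proof.
elim: s u => [|p s IH] u /=; first by rewrite scaler0.
by rewrite IH scalerDr scalerA rmorphM.
Qed.

Lemma rat_comb_term u n : exists s, rat_comb u s = u n.
Proof.
elim: n u => [|n IH] u.
  by exists [:: 1]; rewrite /= rmorph1 scale1r addr0.
have [s sE] := IH (u \o succn); exists (0 :: s).
by rewrite /= sE rmorph0 scale0r add0r.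
Qed.

(** Otherwise a functional that is nonpositive on the rational combinations, hence on
    all terms of u, would be positive at x. *)
Lemma weak_limit_near_rat_comb (F : set_system nat) u (k : nat -> nat) x (e : R) :
  ProperFilter F -> (forall f, dual setT f -> f (u (k n)) @[n --> F] --> f x) ->
  0 < e -> exists s, `|x - rat_comb u s| < e.
Proof.
move=> FF ux e0; apply: contrapT => /forallNP far.
have [||||f [df fneg fx]] :=
    @distance_functional R E (range (rat_comb u)) x e e0.
- by exists [::].
- by move=> _ _ [s _ <-] [t _ <-]; have [r rE] := rat_combD u s t; exists r.
- move=> a d _ d0 [s _ <-]; have M0 : 0 < `|rat_comb u s| + 1 by rewrite ltr_wpDl.
  have /rat_in_itvoo[q] : a < a + d / (`|rat_comb u s| + 1).
    by rewrite ltrDl divr_gt0.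
  rewrite in_itv/= => /andP[aq qa]; exists (ratr q *: rat_comb u s).
    by exists (map ( *%R q) s) => //; rewrite rat_combZ.
  rewrite -scalerBl normrZ distrC gtr0_norm ?subr_gt0//.
  apply: (@le_lt_trans _ _ ((ratr q - a) * (`|rat_comb u s| + 1))).
    by rewrite ler_wpM2l ?lerDl// subr_ge0 ltW.
  by rewrite -ltr_pdivlMr// ltrBlDl.
- by move=> _ [s _ <-]; rewrite leNgt; apply/negP; exact: far.
have /cvgrPdist_lt/(_ e e0)/filter_ex[n] := ux f df.
have [s sE] := rat_comb_term u (k n); have := fneg (u (k n)).
by move=> /(_ (ex_intro2 _ _ s I sE)); rewrite ltr_norml; lra.
Qed.

Lemma filter_forall_lt (F : set_system nat) (P : nat -> set nat) j :
  Filter F -> (forall i, F (P i)) -> F [set n | forall i, (i < j)%N -> P i n].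
Proof.
move=> FF FP; elim: j => [|j IH]; first by apply: filterE.
apply: filterS (filterI IH (FP j)) => n [Pn Pj] i.
by rewrite ltnS leq_eqVlt => /predU1P[->|/Pn].
Qed.

Lemma cvg_geq_id (k : nat -> nat) : (forall n, n <= k n)%N -> k n @[n --> \oo] --> \oo.
Proof.
move=> kn N [m _ mN]; exists m => // n /= mn; apply: mN => /=.
exact: leq_trans (kn n).
Qed.

(** Fix an ultrafilter with weak limit x of u, and functionals phi s norming the
    rational combinations.  The subsequence is chosen so that phi s (u (k n)) tends to
    phi s x for each of these countably many s.  If another functional failed to
    converge along u o k, a second ultrafilter would give a weak limit x' with
    phi s x' = phi s x for all s; as x - x' is a limit of rational combinations, which
    the phi s norm, x' = x. *)
Theorem bounded_weak_subsequence u (B : R) : reflexive_space E ->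
  (\forall n \near \oo, `|u n| <= B) ->
  exists (k : nat -> nat) x, (forall n, n <= k n)%N /\ weak_cvg setT (u \o k) x.
Proof.
move=> refl uB; have [U [UU ooU]] := @ultraFilterLemma nat \oo _.
have PU : ProperFilter U by exact: ultra_proper.
have [x ux] := weak_limit_ultra refl UU (ooU _ uB).
have [phi phiP] := choice (fun s => norming_functional (rat_comb u s)).
pose psi i := phi (odflt [::] (unpickle i)).
(* every set of the ultrafilter is nonempty; intersecting with the terms of index at
   least j makes the extracted indices tend to infinity *)
have /choice[k kP] j : exists m, (j <= m)%N /\
    forall i, (i < j)%N -> `|psi i x - psi i (u m)| < j.+1%:R^-1.
  apply: (@filter_ex _ U).
  apply: filterI; first by apply: ooU; exists j.
  apply: filter_forall_lt => i; have [df _ _] := phiP (odflt [::] (unpickle i)).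
  by have /cvgrPdist_lt := ux _ df; apply; rewrite invr_gt0.
have kn n : (n <= k n)%N := (kP n).1.
have phix s : phi s (u (k j)) @[j --> \oo] --> phi s x.
  apply/cvgrPdist_lt => e e0; near=> j.
  have sj : (pickle s < j)%N by near: j; exists (pickle s).+1.
  have := (kP j).2 _ sj; rewrite /psi pickleK/= => kj.
  apply: lt_trans kj _; near: j; exact: near_infty_natSinv_lt (PosNum e0).
exists k, x; split=> // f df; apply: contrapT => /cvgrPdist_lt.
move=> /existsNP[e /not_implyP[e0 nfx]].
pose A := [set j | e <= `|f x - f (u (k j))|].
have PA : ProperFilter (within A \oo).
  apply: Build_ProperFilter => A0; apply: nfx.
  have {}A0 : \forall j \near \oo, A j -> set0 j := A0.
  by apply: filterS A0 => j jA; rewrite ltNge; apply/negP => /jA.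
have [U' [UU' AU']] := ultraFilterLemma PA.
have PU' : ProperFilter U' by exact: ultra_proper.
have ooU' : \oo `<=` U' by move=> N oN; apply: AU'; apply: filterS oN.
have [|x' ux'] := @weak_limit_ultra U' (u \o k) B refl UU'.
  exact: ooU' (cvg_geq_id kn uB).
(* A belongs to U', so f could not converge to f x along U' *)
suff xx' : x = x'.
  have /cvgrPdist_lt/(_ e e0) := ux' f df; rewrite -xx' => fx.
  have UA : U' A by apply: AU'; exact: withinT.
  by have [j [/= + ]] := filter_ex (filterI fx UA); rewrite /A /= leNgt => ->.
have phixx' s : phi s x = phi s x'.
  have [df' _ _] := phiP s; apply: cvg_unique (ux' _ df') => //.
  by move=> N /phix /ooU'.
apply/eqP; rewrite -subr_eq0 -normr_le0; apply/ler_addgt0Pr => e1 e10; rewrite add0r.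
have e40 : 0 < e1 / 4 by rewrite divr_gt0.
have [s sx] := weak_limit_near_rat_comb (u := u) (k := id) PU ux e40.
have [t tx'] := weak_limit_near_rat_comb (u := u) (k := k) PU' ux' e40.
have [r rE] := rat_combD u s (map ( *%R (-1)) t).
have {rE} rE : rat_comb u r = rat_comb u s - rat_comb u t.
  by rewrite rE rat_combZ rmorphN rmorph1 scaleN1r.
have rxx' : `|(x - x') - rat_comb u r| < e1 / 2.
  have -> : x - x' - rat_comb u r = x - rat_comb u s - (x' - rat_comb u t).
    by rewrite rE !opprD !opprK addrACA.
  by have := ler_normB (x - rat_comb u s) (x' - rat_comb u t); lra.
have [dr rle rn] := phiP r.
have := rle (rat_comb u r - (x - x')); rewrite dualB// rn [phi r (x - _)]dualB//.
rewrite phixx' subrr subr0 distrC.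
by have := ler_normD (x - x' - rat_comb u r) (rat_comb u r); rewrite subrK; lra.
Unshelve. all: by end_near. Qed.

End WeakCompactness.

(** * Weak convergence *)

Section WeakConvergence.
Context {R : realType} {E : normedModType R}.
Implicit Types (u : nat -> E) (f : E -> R) (x : E) (V : set E).

Lemma closed_subspaceZ V (a : R) x : closed_subspace V -> V x -> V (a *: x).
Proof. by move=> [V0 VL _] Vx; rewrite -[_ *: _]addr0; exact: VL. Qed.

Lemma closed_subspaceB V x y : closed_subspace V -> V x -> V y -> V (x - y).
Proof. by move=> [V0 VL _] Vx Vy; rewrite addrC -scaleN1r; exact: VL. Qed.

Lemma dual_comp_proj V f (L : {linear E -> E}) : continuous L ->
  (forall x, V (L x)) -> dual V f -> dual setT (f \o L).
Proof.
move=> Lc LV [fl fc]; apply/dualP; split=> [a x y|x] /=.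
  by rewrite linearP fl.
apply: (@cvg_comp _ _ _ L f _ (within V (nbhs (L x)))).
  move=> N VN; have LN : nbhs x [set y | V (L y) -> N (L y)] := Lc x _ VN.
  by apply: filterS LN => y; apply; exact: LV.
exact: (subspace_continuousP _ _).1 fc _ (LV x).
Qed.

Lemma weak_cvg_proj V (L : {linear E -> E}) u x : continuous L ->
  (forall x, V (L x)) -> weak_cvg setT u x -> weak_cvg V (L \o u) (L x).
Proof. by move=> Lc LV ux f df; exact: (ux _ (dual_comp_proj Lc LV df)). Qed.

Lemma strong_weak_cvg u x : u n @[n --> \oo] --> x -> weak_cvg setT u x.
Proof.
by move=> ux f /dualP[_ fc]; apply: (cvg_comp _ _ ux (fc x)).
Qed.

Lemma weak_cvg_norm_lsc u x (e : R) : weak_cvg setT u x -> 0 < e ->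
  \forall n \near \oo, `|x| - e < `|u n|.
Proof.
move=> ux e0; have [f [df fle fx]] := norming_functional x.
have /cvgrPdist_lt/(_ e e0) := ux f df; apply: filterS => n.
by have := fle (u n); rewrite fx ltr_norml; lra.
Qed.

Lemma normsq_lsc u x (e : R) : weak_cvg setT u x -> 0 < e ->
  \forall n \near \oo, `|x| ^+ 2 - e < `|u n| ^+ 2.
Proof.
move=> ux e0; have d0 : 0 < 2 * `|x| + 1 by rewrite ltr_wpDl ?mulr_ge0.
apply: filterS (weak_cvg_norm_lsc ux (divr_gt0 e0 d0)) => n.
have de : e / (2 * `|x| + 1) * (2 * `|x| + 1) = e by rewrite divfK// gt_eqF.
have {}d0 : 0 < e / (2 * `|x| + 1) by rewrite divr_gt0.
move: d0 de; set d := e / _ => d0.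
have := normr_ge0 x; have := normr_ge0 (u n).
move: (`|x|) (`|u n|) => a b b0 a0 <- ab; have [ad|ad] := leP a d.
  have /(mulr_ge0 a0) : 0 <= d - a by rewrite subr_ge0.
  by have := sqr_ge0 b; have := mulr_ge0 a0 (ltW d0); lra.
have : (a - d) ^+ 2 < b ^+ 2 by rewrite ltr_pXn2r// nnegrE; lra.
by have := sqr_ge0 d; lra.
Qed.

Lemma cvg_normsq u x : u n @[n --> \oo] --> x ->
  `|u n| ^+ 2 @[n --> \oo] --> `|x| ^+ 2.
Proof.
by move=> ux; rewrite expr2; under eq_fun do rewrite expr2; apply: cvgM; exact: cvg_norm.
Qed.

(** Testing against a functional that norms w recovers the coefficients s n, so that
    weak convergence on moving half-lines is strong. *)
Lemma weak_cvg_ray (s : nat -> R) (w_ : nat -> E) w x : w != 0 ->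
  w_ n @[n --> \oo] --> w -> weak_cvg setT (fun n => s n *: w_ n) x ->
  exists l : R, [/\ s n @[n --> \oo] --> l, x = l *: w &
                s n *: w_ n @[n --> \oo] --> x].
Proof.
move=> w0 ww sx; have [f [df _ fw]] := norming_functional w.
have fw0 : f w != 0 by rewrite fw normr_eq0.
have fww : f (w_ n) @[n --> \oo] --> f w by exact: strong_weak_cvg ww _ df.
have sl : s n @[n --> \oo] --> f x / f w.
  have h : f (s n *: w_ n) / f (w_ n) @[n --> \oo] --> f x / f w.
    by apply: cvgM (sx _ df) _; exact: cvgV.
  apply: cvg_trans h; apply: near_eq_cvg; near=> n.
  rewrite (dualZ _ _ df) mulfK//; near: n.
  exact: (cvgr_neq0 _ fww).
have swl : s n *: w_ n @[n --> \oo] --> (f x / f w) *: w by exact: cvgZ.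
suff xE : x = (f x / f w) *: w by exists (f x / f w); rewrite -xE in swl *.
apply/eqP; rewrite -subr_eq0 -normr_eq0.
have [g [dg _ <-]] := norming_functional (x - (f x / f w) *: w).
rewrite (dualB _ _ dg) subr_eq0; apply/eqP.
exact: cvg_unique (sx _ dg) (strong_weak_cvg swl dg).
Unshelve. all: by end_near. Qed.

(** Testing the midpoint of the normalized u n and x against a functional norming x
    shows that its norm tends to 1; uniform convexity then brings the two unit vectors
    together. *)
Lemma uniformly_convex_strong_cvg V u x : uniformly_convex V ->
  (forall (a : R) y, V y -> V (a *: y)) -> (forall n, V (u n)) -> V x ->
  weak_cvg setT u x -> (forall e, 0 < e -> \forall n \near \oo, `|u n| < `|x| + e) ->
  u n @[n --> \oo] --> x.
Proof.
move=> uc VZ Vu Vx ux ule.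
have nux : `|u n| @[n --> \oo] --> `|x|.
  apply/cvgrPdist_lt => e e0; near=> n.
  have : `|x| - e < `|u n| by near: n; exact: weak_cvg_norm_lsc.
  have : `|u n| < `|x| + e by near: n; exact: ule.
  by rewrite ltr_norml; lra.
have [x0|x0] := eqVneq x 0.
  by move: nux; rewrite x0 normr0 => /norm_cvg0P.
have nx : 0 < `|x| by rewrite normr_gt0.
have [f [df fle fx]] := norming_functional x.
have fa : f (u n) / `|u n| @[n --> \oo] --> (1 : R).
  rewrite -(divff (lt0r_neq0 nx)) -{1}fx; apply: cvgM; first exact: ux.
  by apply: cvgV => //; rewrite gt_eqF.
have ua : `|u n|^-1 *: u n @[n --> \oo] --> `|x|^-1 *: x.
  apply/cvgrPdist_lt => e e0; have [d d0 duc] := uc e e0.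
  near=> n; rewrite ltNge; apply/negP => ed.
  have un0 : `|u n| != 0 by near: n; apply: (cvgr_neq0 _ nux); rewrite gt_eqF.
  have fd : 1 - d < f (u n) / `|u n| by near: n; apply: (cvgr_gt _ fa); lra.
  have unit_norm (y : E) : `|y| != 0 -> `| `|y|^-1 *: y| = 1.
    by move=> y0; rewrite normrZ normfV normr_id mulVf.
  have := duc _ _ (VZ _ _ Vx) (VZ _ _ (Vu n))
    (unit_norm _ (lt0r_neq0 nx)) (unit_norm _ un0) ed.
  have := fle (2^-1 *: (`|x|^-1 *: x + `|u n|^-1 *: u n)).
  rewrite (dualZ _ _ df) (dualD _ _ df) !(dualZ _ _ df) fx (mulVf (lt0r_neq0 nx)).
  rewrite [_ * f (u n)]mulrC; lra.
have -> : u = (fun n => `|u n| *: (`|u n|^-1 *: u n)).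
  apply/funext => n; have [->|un0] := eqVneq (u n) 0; first by rewrite !scaler0.
  by rewrite scalerKV// normr_eq0.
have -> : x = `|x| *: (`|x|^-1 *: x) by rewrite scalerKV// gt_eqF.
apply: cvgZ => //.
Unshelve. all: by end_near. Qed.

End WeakConvergence.

(** * Limits inferior and superior *)

Section SemicontinuousLimits.
Context {R : realType}.
Implicit Types a b c : R.

Lemma limf_esup_lt (T : choiceType) (X : filteredType T) (f : X -> \bar R)
    (F : set_system X) (c : \bar R) :
  Filter F -> (limf_esup f F < c)%E -> \forall x \near F, (f x < c)%E.
Proof.
move=> FF /ereal_inf_lt[_ [A FA <-] supA]; apply: filterS FA => x Ax.
by apply: le_lt_trans supA; apply: ereal_sup_ubound; exists x.
Qed.

Lemma limn_einf_ge (b : nat -> R) a : (a%:E <= limn_einf (fun n => (b n)%:E))%E ->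
  forall e, 0 < e -> \forall n \near \oo, a - e < b n.
Proof.
move=> ab e e0; rewrite /limn_einf leeNr in ab.
have /limf_esup_lt : (limn_esup (\- (fun n => (b n)%:E)) < (- a + e)%:E)%E.
  by apply: le_lt_trans ab _; rewrite /= lte_fin ltrDl.
by apply: filterS => n; rewrite /= lte_fin; lra.
Qed.

Lemma limn_einf_cvg (b : nat -> R) a : b n @[n --> \oo] --> a ->
  a%:E = limn_einf (fun n => (b n)%:E).
Proof.
move=> ba; have bE : (b n)%:E @[n --> \oo] --> a%:E.
  by apply/fine_cvgP; split=> //; exact: filterE.
by rewrite (cvg_limn_einf_sup bE).
Qed.

End SemicontinuousLimits.

(** * Differentiable functionals *)

Section Derivatives.
Context {R : realType} {E : normedModType R}.
Implicit Types (f : E -> R) (u h z : E).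

Lemma diff_le_quotient f u h a : differentiable f u ->
  (\forall t \near (0 : R)^'+, f (u + t *: h) - f u <= a * t) -> 'd f u h <= a.
Proof.
move=> df fa; rewrite -deriveE//.
have cvD : t^-1 *: (f (t *: h + u) - f u) @[t --> (0 : R)^'+] --> 'D_h f u.
  by apply: cvg_dnbhs_at_right; exact: (diff_derivable df).
apply: (cvgr_to_le cvD); near=> t.
have t0 : 0 < t by near: t; exact: nbhs_right_gt.
rewrite /GRing.scale/= ler_pdivrMl// mulrC addrC [_ + u]addrC.
by rewrite [- _ + _]addrC; near: t.
Unshelve. all: by end_near. Qed.

Lemma dual_diffB f u v : differentiable f u -> differentiable f v ->
  dual setT (fun h => 'd f v h - 'd f u h).
Proof.
move=> du dv; apply/dualP; split=> [a x y|x].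
  by rewrite !linearP /= /GRing.scale/=; ring.
by apply: continuousB; exact: diff_continuous.
Qed.

Lemma C1_cvg_diff f u h : C1 f -> 'd f v h @[v --> u] --> 'd f u h.
Proof.
move=> [df dfc]; apply/cvgrPdist_lt => e e0; near=> v.
have dd := dual_diffB (df u) (df v).
rewrite distrC; apply: le_lt_trans (le_dual_norm h dd) _.
have h0 : 0 < `|h| + 1 by rewrite ltr_wpDl.
apply: (@le_lt_trans _ _ (dual_norm setT (fun k => 'd f v k - 'd f u k) * (`|h| + 1))).
  by rewrite ler_wpM2l ?dual_norm_ge0// lerDl.
rewrite -ltr_pdivlMr//; near: v; apply: (cvgr_lt _ (dfc u)); exact: divr_gt0.
Unshelve. all: by end_near. Qed.

Lemma line_mean_value f z h d : (forall x, differentiable f x) -> 0 < d ->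
  exists2 t, 0 < t < d & f (z + d *: h) - f z = 'd f (z + t *: h) h * d.
Proof.
move=> df d0; pose g t := f (z + t *: h).
have gE (t : R) : (fun s => s^-1 *: (g (s *: 1 + t) - g t)) =
            (fun s => s^-1 *: (f (s *: h + (z + t *: h)) - f (z + t *: h))).
  apply/funext => s; rewrite /g; congr (_ *: (f _ - _)).
  by rewrite scalerDl addrCA [s *: 1]mulr1.
have dg (t : R) : is_derive t (1 : R) g ('d f (z + t *: h) h).
  apply: DeriveDef.
    by rewrite /derivable gE; apply: diff_derivable.
  by rewrite -deriveE// /derive gE.
have [|t] := @MVT R g _ 0 d d0 (fun t _ => dg t).
  apply: derivable_within_continuous => t _; exact: ex_derive.
by rewrite in_itv/= /g scale0r addr0 subr0 => td ->; exists t.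
Qed.

(** The decrease rate is uniform in the base point z near u, which a derivative at u
    alone would not give: the mean value theorem is applied on the segment from z to
    z + d h, and C1 makes the derivative along h close to the one at u there. *)
Lemma C1_decrease f u h : C1 f -> 'd f u h < 0 ->
  exists m r : R, [/\ 0 < m, 0 < r & forall z d, `|u - z| < r -> 0 < d ->
    d * `|h| < r -> f (z + d *: h) - f z <= - m * d].
Proof.
move=> fC1 fh; exists (- 'd f u h / 2).
have /nbhs_norm0P : \forall k \near (0 : E), 'd f (u + k) h < 'd f u h / 2.
  apply: (@nbhs0P _ _ (fun v => 'd f v h < 'd f u h / 2) u).1.
  by apply: (cvgr_lt _ (C1_cvg_diff fC1)); lra.
move=> [r /= r0 rf]; exists (r / 2); split; rewrite ?divr_gt0 ?oppr_gt0// => z d zr d0 dr.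
have [t /andP[t0 td] ->] := line_mean_value z h fC1.1 d0.
rewrite ler_pM2r// mulNr opprK ltW// (_ : z + _ = u + (z - u + t *: h)); last first.
  by rewrite addrA [u + _]addrC subrK.
apply: rf => /=; apply: le_lt_trans (ler_normD _ _) _; rewrite distrC normrZ gtr0_norm//.
have : t * `|h| <= d * `|h| by rewrite ler_wpM2r// ltW.
lra.
Qed.

End Derivatives.

(** * The direct sum and the half-spaces *)

Section LinkingGeometry.
Context {R : realType} {E : normedModType R}.
Context (Ep E0 Em : set E) (Pp P0 Pm : {linear E -> E}) (I Phi : E -> R).
Implicit Types (u v w h y z : E).

Context (E_reflexive : reflexive_space E)
  (E1_decomposition : topological_decomposition Ep E0 Em Pp P0 Pm)
  (E2 : uniformly_convex Em)
  (PhiE : forall u : E,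
     Phi u = 2^-1 * `|Pp u| ^+ 2 - 2^-1 * `|Pm u| ^+ 2 - I u)
  (Phi_C1 : C1 Phi)
  (I0_ge0 : forall u : E, 0 <= I u)
  (I0_0 : I 0 = 0)
  (I0_gt0 : forall u : E, E0 u -> u <> 0 -> 0 < I u)
  (I0_mono : forall u : E, u <> 0 -> forall s t : R, 0 < s -> s <= t ->
     I (s *: u) / s ^+ 2 <= I (t *: u) / t ^+ 2)
  (I0_limsup : forall u : E, u <> 0 ->
     (limf_esup (fun t : R => (I (t *: u) / t ^+ 2)%:E) (0 : R)^'+
        < (`|u| ^+ 2 / 2)%:E)%E)
  (I0_lim : forall u : E, u <> 0 -> I u <> 0 -> Pp u <> 0 ->
     I (t *: u) / t ^+ 2 @[t --> +oo] --> +oo)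
  (I1 : forall eps : R, 0 < eps -> exists2 kappa : R, 0 < kappa &
     forall phi psi : E, I (phi + psi) <= eps + kappa * (I phi + I psi))
  (I2 : forall (u : E) (w_ : nat -> E) (w : E),
     (forall n, Ep (w_ n)) -> Ep w -> weak_cvg Ep w_ w ->
     I (u + w_ n) @[n --> \oo] --> I (u + w))
  (I3 : forall (u_ : nat -> E) (u : E),
     weak_cvg setT u_ u -> Pp (u_ n) @[n --> \oo] --> Pp u ->
     ((I u)%:E <= limn_einf (fun n => (I (u_ n))%:E))%E /\
     (Pm (u_ n) @[n --> \oo] --> Pm u ->
      (I u)%:E = limn_einf (fun n => (I (u_ n))%:E) ->
      exists2 k : nat -> nat, {homo k : m n / (m < n)%N} &
        P0 (u_ (k n)) @[n --> \oo] --> P0 u)).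

Lemma proj_continuous : [/\ continuous Pp, continuous P0 & continuous Pm].
Proof. by case: E1_decomposition. Qed.

Lemma proj_mem u : [/\ Ep (Pp u), E0 (P0 u) & Em (Pm u)].
Proof. by case: E1_decomposition. Qed.

Lemma proj_sum u : u = Pp u + P0 u + Pm u.
Proof. by case: E1_decomposition. Qed.

Lemma proj_unique u v w : Ep u -> E0 v -> Em w ->
  [/\ Pp (u + v + w) = u, P0 (u + v + w) = v & Pm (u + v + w) = w].
Proof.
move=> Epu E0v Emw; set x := u + v + w.
have [[cp c0 cm] direct _ _ _] := E1_decomposition; have [px zx mx] := proj_mem x.
have [|/subr0_eq-> /subr0_eq-> /subr0_eq->//] :=
  direct _ _ _ (closed_subspaceB cp px Epu) (closed_subspaceB c0 zx E0v)
    (closed_subspaceB cm mx Emw).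
by rewrite [Pp x - u + _]addrACA -opprD addrACA -opprD -proj_sum subrr.
Qed.

Lemma proj_Ep u : Ep u -> Pp u = u.
Proof.
move=> Epu; have [[_ _ _] [z0 _ _] [m0 _ _]] := decomp_closed E1_decomposition.
by have [] := proj_unique Epu z0 m0; rewrite !addr0.
Qed.

Lemma Pm_Ep u : Ep u -> Pm u = 0.
Proof.
move=> Epu; have [[_ _ _] [z0 _ _] [m0 _ _]] := decomp_closed E1_decomposition.
by have [_ _] := proj_unique Epu z0 m0; rewrite !addr0.
Qed.

Lemma Pp_mem u : Ep (Pp u). Proof. by have [] := proj_mem u. Qed.

Lemma proj_kernelP u : set_add Em E0 u <-> Pp u = 0.
Proof.
have [[p0 _ _] _ _] := decomp_closed E1_decomposition; split.
  move=> [y Emy [z E0z <-]]; have [] := proj_unique p0 E0z Emy.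
  by rewrite add0r addrC.
move=> pu0; have [_ z m] := proj_mem u; exists (Pm u) => //; exists (P0 u) => //.
by rewrite addrC [RHS]proj_sum pu0 add0r.
Qed.

Lemma half_spaceP w v : Ep w ->
  half_space E0 Em w v <-> exists2 t, 0 < t & Pp v = t *: w.
Proof.
move=> Epw; have [cp _ _] := decomp_closed E1_decomposition; split.
  move=> [_ [_ [t t0 <-] [y E0y <-]] [z Emz <-]]; exists t => //.
  by have [] := proj_unique (closed_subspaceZ t cp Epw) E0y Emz.
move=> [t t0 pv]; have [_ z m] := proj_mem v.
exists (t *: w + P0 v); last by exists (Pm v) => //; rewrite -pv -proj_sum.
by exists (t *: w); [exists t | exists (P0 v)].
Qed.

Lemma ray_spaceP w v : Ep w ->
  set_add (set_add (line w) E0) Em v <-> exists t, Pp v = t *: w.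
Proof.
move=> Epw; have [cp _ _] := decomp_closed E1_decomposition; split.
  move=> [_ [_ [t _ <-] [y E0y <-]] [z Emz <-]]; exists t.
  by have [] := proj_unique (closed_subspaceZ t cp Epw) E0y Emz.
move=> [t pv]; have [_ z m] := proj_mem v.
exists (t *: w + P0 v); last by exists (Pm v) => //; rewrite -pv -proj_sum.
by exists (t *: w); [exists t | exists (P0 v)].
Qed.

Lemma nehari_pankovP u : nehari_pankov E0 Em Phi u <->
  Pp u <> 0 /\ forall h t, Pp h = t *: Pp u -> 'd Phi u h = 0.
Proof.
split=> [[/proj_kernelP pu0 du]|[pu0 du]]; split=> //.
- move=> h t ph; apply: du.
  have /proj_kernelP mz : Pp (h - t *: u) = 0 by rewrite linearB linearZ ph subrr.
  by exists (h - t *: u) => //; exists (t *: u); [exists t | rewrite subrK].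
- by move=> /proj_kernelP.
- move=> _ [y /proj_kernelP py0 [_ [t _ <-] <-]]; apply: (du _ t).
  by rewrite linearD linearZ py0 add0r.
Qed.

(** * Semicontinuity and boundedness *)

Lemma Phi_le_proj u : Phi u <= 2^-1 * `|Pp u| ^+ 2.
Proof. by rewrite PhiE; have := I0_ge0 u; have := sqr_ge0 `|Pm u|; lra. Qed.

Lemma Phi_scale u (t : R) : Phi (t *: u) =
  t ^+ 2 * (2^-1 * `|Pp u| ^+ 2 - 2^-1 * `|Pm u| ^+ 2) - I (t *: u).
Proof.
have LZ (L : {linear E -> E}) : `|L (t *: u)| ^+ 2 = t ^+ 2 * `|L u| ^+ 2.
  by rewrite linearZ normrZ exprMn real_normK ?num_real.
by rewrite PhiE !LZ; ring.
Qed.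

(** Phi(tu)/t^2 is nonincreasing in t. *)
Lemma Phi_ge0_shrink u (s t : R) : 0 < s -> s <= t ->
  0 <= Phi (t *: u) -> 0 <= Phi (s *: u).
Proof.
move=> s0 st; have t0 := lt_le_trans s0 st.
have [->|/eqP u0] := eqVneq u 0; first by rewrite !scaler0.
rewrite !Phi_scale !subr_ge0 -!ler_pdivrMl ?exprn_gt0// ![_^-1 * _]mulrC.
exact: le_trans (I0_mono u0 s0 st).
Qed.

Lemma I_lsc (u_ : nat -> E) u (e : R) : weak_cvg setT u_ u ->
  Pp (u_ n) @[n --> \oo] --> Pp u -> 0 < e -> \forall n \near \oo, I u - e < I (u_ n).
Proof. by move=> uu pu; apply: limn_einf_ge; have [] := I3 uu pu. Qed.

Lemma weak_cvg_Pm (u_ : nat -> E) u : weak_cvg setT u_ u ->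
  weak_cvg setT (Pm \o u_) (Pm u).
Proof. by apply: weak_cvg_proj => //; have [] := proj_continuous. Qed.

(** The E+ part enters with the wrong sign for weak semicontinuity, hence its strong
    convergence is assumed. *)
Lemma Phi_usc (u_ : nat -> E) u (e : R) : weak_cvg setT u_ u ->
  Pp (u_ n) @[n --> \oo] --> Pp u -> 0 < e ->
  \forall n \near \oo, Phi (u_ n) < Phi u + e.
Proof.
move=> uu pu e0; have e30 : 0 < e / 3 by rewrite divr_gt0.
near=> n.
have : I u - e / 3 < I (u_ n) by near: n; exact: I_lsc.
have : `|Pm u| ^+ 2 - e / 3 < `|Pm (u_ n)| ^+ 2.
  by near: n; exact: (normsq_lsc (weak_cvg_Pm uu)).
have : `|Pp (u_ n)| ^+ 2 < `|Pp u| ^+ 2 + e / 3.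
  by near: n; apply: (cvgr_lt _ (cvg_normsq pu)); rewrite ltrDl.
rewrite !PhiE; lra.
Unshelve. all: by end_near. Qed.

(** v stands for a weak limit of normalized points of an unbounded sequence.  For
    s = 0, Phi v >= 0 gives v- = 0 and I v = 0, and I is positive on E0 minus 0.  Let
    s > 0.  If I is not identically zero on the half-line of v, its superquadratic
    growth makes Phi negative far out.  If I vanishes on the half-line of v, then
    |v-| <= |v+| = s |w| makes the quadratic part of Phi at rv + w at least
    r s |w|^2, while I1 bounds I(rv + w) uniformly in r. *)
Lemma asymptotic_direction_trivial w v (s M : R) : Ep w -> w <> 0 ->
  0 <= s -> Pp v = s *: w -> (forall t, 0 < t -> 0 <= Phi (t *: v)) ->
  (forall u, half_space E0 Em w u -> Phi u <= M) -> v = 0.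
Proof.
move=> Epw w0 s0 pv Phiv PhiM; apply: contrapT => v0.
have pm : `|Pm v| ^+ 2 <= `|Pp v| ^+ 2.
  have := Phiv 1 ltr01; rewrite scale1r PhiE; have := I0_ge0 v; lra.
move: s0; rewrite le_eqVlt => /predU1P[s0|s0].
  have pv0 : Pp v = 0 by rewrite pv -s0 scale0r.
  have mv0 : Pm v = 0.
    apply/normr0_eq0/eqP; move: pm; rewrite pv0 normr0 expr0n/=.
    by rewrite le_eqVlt ltNge sqr_ge0 orbF sqrf_eq0.
  have E0v : E0 v by rewrite [v]proj_sum pv0 mv0 add0r addr0; have [] := proj_mem v.
  have := Phiv 1 ltr01; rewrite scale1r PhiE pv0 mv0 normr0 expr0n/=.
  have := I0_gt0 E0v v0; lra.
have pv0 : Pp v <> 0.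
  by rewrite pv => /eqP; rewrite scaler_eq0 gt_eqF//= => /eqP.
have [[t t0 It]|I0] := pselect (exists2 t, 0 < t & I (t *: v) <> 0).
  have tv0 : t *: v <> 0 by apply/eqP; rewrite scaler_eq0 gt_eqF//=; exact/eqP.
  have ptv0 : Pp (t *: v) <> 0.
    by rewrite linearZ; apply/eqP; rewrite scaler_eq0 gt_eqF//=; exact/eqP.
  have /cvgryPgt/(_ (t ^+ 2 * `|Pp v| ^+ 2)) := I0_lim tv0 It ptv0.
  move=> Ilarge; near (+oo_R) => r.
  have r0 : 0 < r by near: r; exact: nbhs_pinfty_gt.
  have : t ^+ 2 * `|Pp v| ^+ 2 < I (r *: (t *: v)) / r ^+ 2 by near: r.
  rewrite ltr_pdivlMr ?exprn_gt0// scalerA.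
  have := Phiv _ (mulr_gt0 r0 t0); rewrite Phi_scale exprMn.
  have := sqr_ge0 `|Pm v|; have := sqr_ge0 `|Pp v|.
  have := exprn_gt0 2 t0; have := exprn_gt0 2 r0; nra.
have {}I0 t : 0 < t -> I (t *: v) = 0.
  by move=> t0; apply: contrapT => It; apply: I0; exists t.
have [kap kap0 Ikap] := I1 (ltr01 : 0 < 1 :> R).
pose C := 1 + kap * I w.
have nw : 0 < `|w| by rewrite normr_gt0; exact/eqP.
(* at this r the lower bound r s |w|^2 equals |M| + C + 1 *)
pose r := (`|M| + C + 1) / (s * `|w| ^+ 2).
have C0 : 0 <= C by rewrite addr_ge0// mulr_ge0// ltW.
have sw0 : 0 < s * `|w| ^+ 2 by rewrite mulr_gt0// exprn_gt0.
have r0 : 0 < r by rewrite divr_gt0// ltr_wpDl// addr_ge0.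
have rE : r * (s * `|w| ^+ 2) = `|M| + C + 1 by rewrite /r divfK ?gt_eqF.
clearbody r.
have ppu : Pp (r *: v + w) = (r * s + 1) *: w.
  by rewrite linearD linearZ/= pv (proj_Ep Epw) scalerA scalerDl scale1r.
have /PhiM : half_space E0 Em w (r *: v + w).
  by apply/half_spaceP => //; exists (r * s + 1) => //; rewrite ltr_wpDl// mulr_ge0// ltW.
have pmu : Pm (r *: v + w) = r *: Pm v by rewrite linearD linearZ/= (Pm_Ep Epw) addr0.
have := Ikap (r *: v) w; rewrite I0// add0r -/C PhiE ppu pmu !normrZ !exprMn.
rewrite !real_normK ?num_real//.
move: pm; rewrite pv normrZ exprMn real_normK ?num_real//.
rewrite -subr_ge0 => /(mulr_ge0 (sqr_ge0 r)).
by have := ler_norm M; have := exprn_gt0 2 nw; lra.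
Unshelve. all: by end_near. Qed.

(** No value is lost in the limit, although |u-|^2 and I are both lower
    semicontinuous; so each of them converges to its value at y.  Uniform convexity
    gives the strong convergence of the E- parts, and I3 then that of the E0 parts. *)
Lemma strong_limit_of_max (u_ : nat -> E) y a : weak_cvg setT u_ y ->
  Pp (u_ n) @[n --> \oo] --> Pp y ->
  (forall e, 0 < e -> \forall n \near \oo, a - e < Phi (u_ n)) -> Phi y <= a ->
  exists2 k : nat -> nat, (forall n, n <= k n)%N & u_ (k n) @[n --> \oo] --> y.
Proof.
move=> uy py Phia ya.
have mlt e : 0 < e -> \forall n \near \oo, `|Pm (u_ n)| < `|Pm y| + e.
  move=> e0; have d0 : 0 < e ^+ 2 / 5 by rewrite divr_gt0// exprn_gt0.
  near=> n; rewrite -(@ltr_pXn2r _ 2)// ?nnegrE ?addr_ge0// ?ltW//.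
  have : I y - e ^+ 2 / 5 < I (u_ n) by near: n; exact: I_lsc.
  have : a - e ^+ 2 / 5 < Phi (u_ n) by near: n; exact: Phia.
  have : `|Pp (u_ n)| ^+ 2 < `|Pp y| ^+ 2 + e ^+ 2 / 5.
    by near: n; apply: (cvgr_lt _ (cvg_normsq py)); rewrite ltrDl.
  have := mulr_ge0 (normr_ge0 (Pm y)) (ltW e0).
  move: ya; rewrite !PhiE; lra.
have my : Pm (u_ n) @[n --> \oo] --> Pm y.
  have [_ _ cm] := decomp_closed E1_decomposition.
  apply: uniformly_convex_strong_cvg E2 _ _ _ (weak_cvg_Pm uy) mlt.
  - by move=> b z; exact: closed_subspaceZ.
  - by move=> n /=; have [] := proj_mem (u_ n).
  - by have [] := proj_mem y.
have Iy : I (u_ n) @[n --> \oo] --> I y.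
  apply/cvgrPdist_lt => e e0; have d0 : 0 < e / 3 by rewrite divr_gt0.
  near=> n.
  have : I y - e / 3 < I (u_ n) by near: n; exact: I_lsc.
  have : a - e / 3 < Phi (u_ n) by near: n; exact: Phia.
  have : `|Pp (u_ n)| ^+ 2 < `|Pp y| ^+ 2 + e / 3.
    by near: n; apply: (cvgr_lt _ (cvg_normsq py)); rewrite ltrDl.
  have : `|Pm y| ^+ 2 - e / 3 < `|Pm (u_ n)| ^+ 2.
    by near: n; exact: (normsq_lsc (weak_cvg_Pm uy)).
  move: ya; rewrite ltr_norml !PhiE; lra.
have [k kmono zy] := (I3 uy py).2 my (limn_einf_cvg Iy).
have kn n : (n <= k n)%N.
  by elim: n => // n IH; exact: leq_ltn_trans IH (kmono _ _ (ltnSn n)).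
exists k => //; rewrite [y]proj_sum.
under eq_fun do rewrite [u_ _]proj_sum.
apply: cvgD; [apply: cvgD|] => //.
- exact: cvg_comp (cvg_geq_id kn) py.
- exact: cvg_comp (cvg_geq_id kn) my.
Unshelve. all: by end_near. Qed.

Lemma Phi0 : Phi 0 = 0.
Proof. by rewrite PhiE !linear0 !normr0 I0_0; lra. Qed.

(** Blow-up: the normalized points would have weak limit 0 by
    [asymptotic_direction_trivial], and strongly so by [strong_limit_of_max]. *)
Lemma bounded_of_Phi_ge0 (w_ u_ : nat -> E) (t : nat -> R) w M : Ep w -> w <> 0 ->
  w_ n @[n --> \oo] --> w -> (forall n, 0 < t n) ->
  (forall n, Pp (u_ n) = t n *: w_ n) -> (\forall n \near \oo, 0 <= Phi (u_ n)) ->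
  (forall v, half_space E0 Em w v -> Phi v <= M) ->
  exists B : R, \forall n \near \oo, `|u_ n| <= B.
Proof.
move=> Epw w0 ww t0 pu Phiu PhiM; apply: contrapT => unbounded.
have /choice[k kP] j : exists m, [/\ (j <= m)%N, j%:R < `|u_ m| & 0 <= Phi (u_ m)].
  apply: contrapT => far; apply: unbounded; exists j%:R.
  near=> m; rewrite leNgt; apply/negP => jm; apply: far; exists m; split=> //.
    by near: m; exists j.
  by near: m.
have kn n : (n <= k n)%N by have [] := kP n.
have nu0 j : 0 < `|u_ (k j)| by have [_ + _] := kP j; exact: le_lt_trans.
pose v j := `|u_ (k j)|^-1 *: u_ (k j).
have v1 j : `|v j| = 1 by rewrite normrZ normfV normr_id mulVf// gt_eqF.
have [|l [x [ln vx]]] := @bounded_weak_subsequence _ _ v 1 E_reflexive.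
  by apply: filterE => n; rewrite v1.
have kln n : (n <= (k \o l) n)%N by exact: leq_trans (ln n) (kn _).
have [Ppc _ _] := proj_continuous.
pose s j := `|u_ (k (l j))|^-1 * t (k (l j)).
have pv j : Pp (v (l j)) = s j *: w_ (k (l j)) by rewrite linearZ/= pu scalerA.
have wl : w_ (k (l n)) @[n --> \oo] --> w by exact: (cvg_comp _ _ (cvg_geq_id kln) ww).
have px : weak_cvg setT (Pp \o (v \o l)) (Pp x) by exact: weak_cvg_proj.
have [||s0 [ss0 pxE pvx]] := @weak_cvg_ray _ _ s (w_ \o (k \o l)) w (Pp x) _ wl.
- exact/eqP.
- by move: px; congr weak_cvg; apply/funext => j /=; exact: pv.
have s00 : 0 <= s0.
  apply: (cvgr_to_ge ss0); apply: filterE => n.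
  by rewrite mulr_ge0 ?invr_ge0// ltW.
have {}pvx : Pp ((v \o l) n) @[n --> \oo] --> Pp x.
  by under eq_fun do rewrite /= pv.
have Phiv T : 0 < T -> \forall n \near \oo, 0 <= Phi (T *: (v \o l) n).
  move=> T0; near=> n; rewrite /= /v scalerA.
  have [_ lk Pk] := kP (l n).
  have Tl : T <= (l n)%:R.
    apply: (@le_trans _ _ n%:R); last by rewrite ler_nat.
    by near: n; exact: nbhs_infty_ger.
  apply: (@Phi_ge0_shrink _ _ 1); rewrite ?scale1r// ?mulr_gt0 ?invr_gt0//.
  by rewrite ler_pdivrMr// mul1r (le_trans Tl)// ltW.
have Phix T : 0 < T -> 0 <= Phi (T *: x).
  move=> T0; rewrite leNgt; apply/negP => neg.
  have TvT : weak_cvg setT (fun n => T *: (v \o l) n) (T *: x).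
    move=> f df; under eq_fun do rewrite (dualZ _ _ df).
    by rewrite (dualZ _ _ df); apply: cvgMr; exact: vx.
  have pTv : Pp (T *: (v \o l) n) @[n --> \oo] --> Pp (T *: x).
    rewrite linearZ/=; under eq_fun do rewrite linearZ/=.
    exact: cvgZr.
  have := Phi_usc TvT pTv (_ : 0 < - Phi (T *: x)); rewrite oppr_gt0 => /(_ neg).
  rewrite subrr => usc; have [n [+ ]] := filter_ex (filterI (Phiv T T0) usc).
  by rewrite leNgt => /negP.
have x0 : x = 0 := asymptotic_direction_trivial Epw w0 s00 pxE Phix PhiM.
have [||m mn vm] := @strong_limit_of_max (v \o l) x 0 vx pvx.
- move=> e e0; apply: filterS (Phiv 1 ltr01) => n.
  by rewrite scale1r sub0r; apply: lt_le_trans; rewrite oppr_lt0.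
- by rewrite x0 Phi0.
have vm1 : `|(v \o l) (m n)| @[n --> \oo] --> (1 : R).
  by under eq_fun do rewrite /= v1; exact: cvg_cst.
have /eqP : 1 = `|x| by exact: cvg_unique vm1 (cvg_norm vm).
by rewrite x0 normr0 oner_eq0.
Unshelve. all: by end_near. Qed.

(** The half-spaces may vary with n: a constant w_ gives maximizers on E_w, and a
    convergent w_ compares E_w with tilted half-spaces.  The limit y has y+ <> 0
    because Phi is nonpositive where u+ = 0. *)
Lemma maximizing_limit (w_ u_ : nat -> E) (t : nat -> R) w (a M : R) : Ep w -> w <> 0 ->
  w_ n @[n --> \oo] --> w -> (forall n, 0 < t n) ->
  (forall n, Pp (u_ n) = t n *: w_ n) -> 0 < a ->
  (forall e, 0 < e -> \forall n \near \oo, a - e < Phi (u_ n)) ->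
  (forall v, half_space E0 Em w v -> Phi v <= M) ->
  exists k y, [/\ forall n, (n <= k n)%N, weak_cvg setT (u_ \o k) y,
    Pp (u_ (k n)) @[n --> \oo] --> Pp y, half_space E0 Em w y & a <= Phi y].
Proof.
move=> Epw w0 ww t0 pu a0 Phia PhiM.
have [|B uB] := bounded_of_Phi_ge0 Epw w0 ww t0 pu _ PhiM.
  by apply: filterS (Phia a a0) => n; rewrite subrr => /ltW.
have [k [y [kn uy]]] := bounded_weak_subsequence E_reflexive uB.
have [Ppc _ _] := proj_continuous.
have wk : w_ (k n) @[n --> \oo] --> w by exact: (cvg_comp _ _ (cvg_geq_id kn) ww).
have py : weak_cvg setT (Pp \o (u_ \o k)) (Pp y) by exact: weak_cvg_proj.
have [||s0 [ts0 pyE pucvg]] := @weak_cvg_ray _ _ (t \o k) (w_ \o k) w (Pp y) _ wk.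
- exact/eqP.
- by move: py; congr weak_cvg; apply/funext => j /=; exact: pu.
have s00 : 0 <= s0 by apply: (cvgr_to_ge ts0); apply: filterE => n; rewrite ltW// t0.
have {}pucvg : Pp ((u_ \o k) n) @[n --> \oo] --> Pp y.
  by under eq_fun do rewrite /= pu.
have ay : a <= Phi y.
  apply/ler_addgt0Pr => e e0; have e20 : 0 < e / 2 by rewrite divr_gt0.
  have Phiak : \forall n \near \oo, a - e / 2 < Phi ((u_ \o k) n).
    exact: (cvg_geq_id kn (Phia _ e20)).
  have [n [+ +]] := filter_ex (filterI Phiak (Phi_usc uy pucvg e20)).
  by move=> /lt_trans h /h; lra.
exists k, y; split=> //; apply/half_spaceP => //; exists s0 => //.
rewrite lt_neqAle s00 andbT; apply: contraPneq (lt_le_trans a0 ay) => s0E.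
have := Phi_le_proj y; rewrite pyE -s0E scale0r normr0 expr0n/= mulr0.
by move=> /le_gtF ->.
Qed.

(** * Maximizers on half-spaces and critical points *)

Lemma maximizer_diff w y : Ep w -> half_space E0 Em w y ->
  (forall v, half_space E0 Em w v -> Phi v <= Phi y) ->
  forall h t, Pp h = t *: w -> 'd Phi y h = 0.
Proof.
move=> Epw /(half_spaceP _ Epw)[s s0 py] ymax.
have dle h t : Pp h = t *: w -> 'd Phi y h <= 0.
  move=> ph; apply: diff_le_quotient; first exact: Phi_C1.1.
  near=> e; have e0 : 0 < e by near: e; exact: nbhs_right_gt.
  rewrite mul0r subr_le0; apply: ymax; apply/half_spaceP => //.
  exists (s + e * t); last by rewrite linearD linearZ/= py ph scalerA scalerDl.
  have t0 : 0 < `|t| + 1 by rewrite ltr_wpDl.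
  have : e < s / (`|t| + 1) by near: e; apply: nbhs_right_lt; exact: divr_gt0.
  rewrite ltr_pdivlMr// => es; have := mulr_ge0 (ltW e0) (_ : 0 <= `|t| + t).
  have := ler_norm (- t); rewrite normrN => tt; lra.
move=> h t ph; apply/eqP; rewrite eq_le (dle _ _ ph)/=.
by have := dle (- h) (- t); rewrite !linearN/= ph scaleNr oppr_le0; exact.
Unshelve. all: by end_near. Qed.

Lemma Phi_pos_on_ray w : Ep w -> w <> 0 ->
  exists2 v, half_space E0 Em w v & 0 < Phi v.
Proof.
move=> Epw w0; have /limf_esup_lt Iw := I0_limsup w0.
near ((0 : R)^'+) => t; have t0 : 0 < t by near: t; exact: nbhs_right_gt.
have : ((I (t *: w) / t ^+ 2)%:E < (`|w| ^+ 2 / 2)%:E)%E by near: t.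
rewrite lte_fin ltr_pdivrMr ?exprn_gt0// => It.
exists (t *: w).
  by apply/half_spaceP => //; exists t => //; rewrite linearZ/= proj_Ep.
by rewrite Phi_scale proj_Ep// Pm_Ep// normr0; lra.
Unshelve. all: by end_near. Qed.

(** If u+ = 0, then - Phi(tu)/t^2 is nondecreasing in t, so Phi'(u)u = 0 forces
    |u-|^2 / 2 + I(u) <= 0; thus u lies in E0 and I(u) = 0. *)
Lemma critical_nehari_pankov u : u <> 0 -> critical Phi u ->
  nehari_pankov E0 Em Phi u.
Proof.
move=> u0 cu; apply/nehari_pankovP; split=> [pu0|h t _]; last exact: cu.
pose k := 2^-1 * `|Pm u| ^+ 2 + I u.
have dk : 'd Phi u u <= - (2 * k).
  apply: diff_le_quotient; first exact: Phi_C1.1.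
  near=> e; have e0 : 0 < e by near: e; exact: nbhs_right_gt.
  rewrite -[X in X + e *: _]scale1r -scalerDl Phi_scale PhiE pu0 normr0.
  have := I0_mono u0 ltr01 (_ : 1 <= 1 + e); rewrite lerDl => /(_ (ltW e0)).
  rewrite scale1r expr1n divr1 ler_pdivlMr ?exprn_gt0 ?addr_gt0//.
  have : 0 <= e ^+ 2 * k by rewrite mulr_ge0 ?sqr_ge0// addr_ge0// mulr_ge0.
  rewrite /k; lra.
have := I0_ge0 u; have := sqr_ge0 `|Pm u|.
rewrite cu// /k in dk => m0 Iu0.
have mu0 : Pm u = 0.
  apply/normr0_eq0/eqP; rewrite -sqrf_eq0; apply/eqP; lra.
have E0u : E0 u by rewrite [u]proj_sum pu0 mu0 add0r addr0; have [] := proj_mem u.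
have := I0_gt0 E0u u0; lra.
Unshelve. all: by end_near. Qed.

(** * The minimax level is attained *)

Lemma half_space_scale w (a : R) v : Ep w -> 0 < a ->
  half_space E0 Em (a *: w) v -> half_space E0 Em w v.
Proof.
have [cp _ _] := decomp_closed E1_decomposition.
move=> Epw a0 /(half_spaceP _ (closed_subspaceZ a cp Epw))[t t0 pv].
by apply/half_spaceP => //; exists (t * a); rewrite ?mulr_gt0// -scalerA.
Qed.

(** With |w| = 1 the left-hand side would be Phi v; in general it is larger, since
    |w| <= 1.  The case w = 0 is included on purpose, in order to be refuted with
    v = 0 and t large. *)
Lemma weak_limit_minimizing_rays (w_ : nat -> E) w c :
  (forall n, Ep (w_ n)) -> (forall n, `|w_ n| = 1) -> weak_cvg setT w_ w ->
  (forall e, 0 < e -> \forall n \near \oo,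
     forall v, half_space E0 Em (w_ n) v -> Phi v <= c + e) ->
  forall v t, 0 < t -> Pp v = t *: w ->
    2^-1 * t ^+ 2 - 2^-1 * `|Pm v| ^+ 2 - I v <= c.
Proof.
move=> Epw_ w_1 ww wc v t t0 pv.
have [cp _ _] := decomp_closed E1_decomposition; have [Ppc _ _] := proj_continuous.
pose z n := t *: w_ n.
have pz n : Pp (z n) = z n by apply: proj_Ep; exact: closed_subspaceZ.
have mz n : Pm (z n) = 0 by apply: Pm_Ep; exact: closed_subspaceZ.
have zw : weak_cvg setT z (Pp v).
  move=> f df; rewrite pv /z; under eq_fun do rewrite (dualZ _ _ df).
  by rewrite (dualZ _ _ df); apply: cvgMr; exact: ww.
have Epv := Pp_mem v.
have zEp : weak_cvg Ep z (Pp v).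
  have := weak_cvg_proj Ppc Pp_mem zw.
  rewrite (proj_Ep Epv); congr weak_cvg; apply/funext => n; exact: pz.
have Iz := I2 (u := v - Pp v) (fun n => closed_subspaceZ t cp (Epw_ n)) Epv zEp.
rewrite subrK in Iz.
apply/ler_addgt0Pr => e e0; have e20 : 0 < e / 2 by rewrite divr_gt0.
near \oo => n.
have : I (v - Pp v + z n) < I v + e / 2.
  by near: n; apply: (cvgr_lt _ Iz); rewrite ltrDl.
have pvz : Pp (v - Pp v + z n) = z n.
  by rewrite linearD linearB/= [Pp (Pp v)]proj_Ep// subrr add0r pz.
have mvz : Pm (v - Pp v + z n) = Pm v.
  by rewrite linearD linearB/= (Pm_Ep Epv) mz subr0 addr0.
have : Phi (v - Pp v + z n) <= c + e / 2.
  have : forall v, half_space E0 Em (w_ n) v -> Phi v <= c + e / 2.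
    by near: n; exact: wc.
  by apply; apply/half_spaceP => //; exists t.
rewrite PhiE pvz mvz normrZ w_1 mulr1 real_normK ?num_real//; lra.
Unshelve. all: by end_near. Qed.

(** The weak limit of unit vectors spanning almost minimizing half-spaces is nonzero
    and spans a minimizing one, on which a maximizing sequence then converges. *)
Lemma minimal_ray_attained c :
  (forall w e, Ep w -> w <> 0 -> 0 < e ->
     exists2 v, half_space E0 Em w v & c - e < Phi v) ->
  (forall e, 0 < e -> exists w, [/\ Ep w, w <> 0 &
     forall v, half_space E0 Em w v -> Phi v <= c + e]) ->
  exists w y, [/\ Ep w, w <> 0, half_space E0 Em w y, Phi y = c &
     forall v, half_space E0 Em w v -> Phi v <= c] /\ 0 < c.
Proof.
move=> clow cup; have [cp _ _] := decomp_closed E1_decomposition.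
have /choice[b bP] (n : nat) : exists w, [/\ Ep w, `|w| = 1 &
    forall v, half_space E0 Em w v -> Phi v <= c + n.+1%:R^-1].
  have [|w [Epw w0 wc]] := cup n.+1%:R^-1; first by rewrite invr_gt0.
  have nw : 0 < `|w| by rewrite normr_gt0; exact/eqP.
  exists (`|w|^-1 *: w); split; first exact: closed_subspaceZ.
    by rewrite normrZ normfV normr_id mulVf// gt_eqF.
  by move=> v /half_space_scale wv; apply: wc; apply: wv; rewrite ?invr_gt0.
have [|k [x [kn bx]]] := @bounded_weak_subsequence _ _ b 1 E_reflexive.
  by apply: filterE => n; have [_ ->] := bP n.
have [Ppc _ _] := proj_continuous; pose w := Pp x.
have Epw : Ep w := Pp_mem x.
have Epb n : Ep ((b \o k) n) by have [] := bP (k n).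
have b1 n : `|(b \o k) n| = 1 by have [] := bP (k n).
have bw : weak_cvg setT (b \o k) w.
  have : weak_cvg setT (Pp \o (b \o k)) w by exact: weak_cvg_proj.
  by congr weak_cvg; apply/funext => n; exact: proj_Ep.
have bc e : 0 < e -> \forall n \near \oo,
    forall v, half_space E0 Em ((b \o k) n) v -> Phi v <= c + e.
  move=> e0; near=> n; have [_ _ bv] := bP (k n).
  move=> v /bv /le_trans; apply; rewrite lerD2l.
  apply: (@le_trans _ _ n.+1%:R^-1); first by rewrite lef_pV2 ?posrE// ler_nat ltnS.
  by apply: ltW; near: n; exact: near_infty_natSinv_lt (PosNum e0).
have wle := weak_limit_minimizing_rays Epb b1 bw bc.
have w0 : w <> 0.
  move=> w0; have T0 : 0 < `|c| + 2 by rewrite ltr_wpDl.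
  have := wle 0 (`|c| + 2) T0; rewrite w0 !linear0 I0_0 normr0.
  by move=> /(_ erefl); have := ler_norm c; have := normr_ge0 c; nra.
have w1 : `|w| <= 1.
  apply/ler_addgt0Pr => e e0.
  by have [n] := filter_ex (weak_cvg_norm_lsc bw e0); rewrite b1; lra.
have wc v : half_space E0 Em w v -> Phi v <= c.
  move=> /(half_spaceP _ Epw)[t t0 pv]; have := wle v t t0 pv.
  apply: le_trans; rewrite PhiE pv normrZ exprMn real_normK ?num_real//.
  have : `|w| ^+ 2 <= 1 by rewrite expr_le1.
  by rewrite -subr_ge0 => /(mulr_ge0 (sqr_ge0 t)); lra.
have [v wv Phiv] := Phi_pos_on_ray Epw w0.
have c0 : 0 < c := lt_le_trans Phiv (wc v wv).
have /choice[u uP] (n : nat) : exists u, half_space E0 Em w u /\ c - n.+1%:R^-1 < Phi u.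
  by have [|u] := clow w n.+1%:R^-1 Epw w0; rewrite ?invr_gt0//; exists u.
have /choice[t tP] n : exists t, 0 < t /\ Pp (u n) = t *: w.
  by have [/(half_spaceP _ Epw)[t t0 pu] _] := uP n; exists t.
have [||||_ [y [_ _ _ wy cy]]] :=
    @maximizing_limit (fun=> w) u t w c c Epw w0 _ _ _ c0 _ wc.
- exact: cvg_cst.
- by move=> n; have [] := tP n.
- by move=> n; have [] := tP n.
- move=> e e0; near=> n; have [_ + ] := uP n; apply: le_lt_trans.
  rewrite lerD2l lerN2; apply: ltW; near: n; exact: near_infty_natSinv_lt (PosNum e0).
by exists w, y; split=> //; split=> //; apply/eqP; rewrite eq_le cy wc.
Unshelve. all: by end_near. Qed.

(** If Phi'(u)h < 0 for some h in E+, compare the near-maximizers y_n of the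
    half-spaces tilted by tau_n h with the points y_n - d_n h of E_(u+): their values
    would differ by at least m d_n, with d_n of order tau_n, and by less than
    tau_n^2. *)
Lemma minimizer_critical u c : 0 < c ->
  (forall w e, Ep w -> w <> 0 -> 0 < e ->
     exists2 v, half_space E0 Em w v & c - e < Phi v) ->
  Phi u = c -> Pp u <> 0 -> (forall h, Pp h = 0 -> 'd Phi u h = 0) ->
  (forall v, half_space E0 Em (Pp u) v -> Phi v <= Phi u) ->
  (forall v, half_space E0 Em (Pp u) v ->
    (forall z, half_space E0 Em (Pp u) z -> Phi z <= Phi v) -> v = u) ->
  critical Phi u.
Proof.
move=> c0 clow Phiu pu0 duz umax uuniq.
have Epu := Pp_mem u.
have [cp _ _] := decomp_closed E1_decomposition.
suff dge h : Ep h -> 0 <= 'd Phi u h.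
  move=> h _; rewrite [h]proj_sum -addrA linearD/=.
  have [ph zh mh] := proj_mem h.
  have p0 : Pp (P0 h + Pm h) = 0.
    by apply/proj_kernelP; exists (Pm h) => //; exists (P0 h) => //; rewrite addrC.
  rewrite (duz _ p0) addr0; apply/eqP; rewrite eq_le dge// andbT -oppr_ge0.
  by rewrite -linearN dge// -scaleN1r; exact: closed_subspaceZ.
move=> Eph; rewrite leNgt; apply/negP => dneg.
have [m [r [m0 r0 decr]]] := C1_decrease Phi_C1 dneg.
have npu : 0 < `|Pp u| by rewrite normr_gt0; exact/eqP.
have nh1 : 0 < `|h| + 1 by rewrite ltr_wpDl.
(* the factor makes |tau n *: h| < |u+|, so that no tilted direction vanishes *)
pose tau n := `|Pp u| / (`|h| + 1) / n.+1%:R.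
have tau0 n : 0 < tau n by rewrite !divr_gt0.
have tau_cvg : tau n @[n --> \oo] --> (0 : R).
  rewrite -(mulr0 (`|Pp u| / (`|h| + 1))); apply: cvgMr.
  exact: cvg_harmonic.
pose w n := Pp u + tau n *: h.
have Epw n : Ep (w n) by have [_ pL _] := cp; rewrite /w addrC; exact: pL.
have w0 n : w n <> 0.
  move=> /eqP; rewrite addr_eq0 => /eqP puE.
  have pE : `|Pp u| = tau n * `|h| by rewrite puE normrN normrZ gtr0_norm.
  have : tau n * (`|h| + 1) <= `|Pp u|.
    by rewrite /tau mulrAC divfK ?gt_eqF// ler_pdivrMr// ler_peMr// ler1n.
  by have := tau0 n; rewrite pE; lra.
have wu : w n @[n --> \oo] --> Pp u.
  rewrite -[X in _ --> X]addr0 -(scale0r h); apply: cvgD; first exact: cvg_cst.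
  exact: cvgZl.
have /choice[y yP] n : exists y, half_space E0 Em (w n) y /\ c - tau n ^+ 2 < Phi y.
  have [|v wv cv] := clow (w n) (tau n ^+ 2) (Epw n) (w0 n); first exact: exprn_gt0.
  by exists v.
have /choice[t tP] n : exists t, 0 < t /\ Pp (y n) = t *: w n.
  by have [/(half_spaceP _ (Epw n))[t t0 py] _] := yP n; exists t.
have tau2 : tau n ^+ 2 @[n --> \oo] --> (0 : R).
  by rewrite -(mulr0 (0 : R)); under eq_fun do rewrite expr2; exact: cvgM.
have Phiy e : 0 < e -> \forall n \near \oo, c - e < Phi (y n).
  move=> e0; near=> n; have [_] := yP n; apply: le_lt_trans.
  by rewrite lerD2l lerN2; apply: ltW; near: n; exact: (cvgr_lt _ tau2).
have tpos n : 0 < t n by have [] := tP n.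
have pyE n : Pp (y n) = t n *: w n by have [] := tP n.
have [k [x [kn yx px wx cx]]] :=
  maximizing_limit Epu pu0 wu tpos pyE c0 Phiy umax.
have xu : x = u.
  by apply: uuniq => // z /umax /le_trans; apply; rewrite Phiu.
have Phiyk e : 0 < e -> \forall n \near \oo, c - e < Phi ((y \o k) n).
  by move=> e0; exact: (cvg_geq_id kn (Phiy e e0)).
have [|l ln yu] := strong_limit_of_max yx px Phiyk; first by rewrite xu Phiu.
pose q := k \o l; rewrite {}xu in yu px.
have qn n : (n <= q n)%N by exact: leq_trans (ln n) (kn _).
have {}yu : y (q n) @[n --> \oo] --> u := yu.
have t1 : t (q n) @[n --> \oo] --> (1 : R).
  have [|||s [ts pE _]] := @weak_cvg_ray _ _ (t \o q) (w \o q) (Pp u) (Pp u).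
  - exact/eqP.
  - exact: (cvg_comp _ _ (cvg_geq_id qn) wu).
  - have -> : (fun n => (t \o q) n *: (w \o q) n) = Pp \o (y \o q).
      by apply/funext => n /=; rewrite pyE.
    have [Ppc _ _] := proj_continuous.
    by apply: weak_cvg_proj => //; exact: strong_weak_cvg.
  - suff <- : s = 1 by exact: ts.
    apply/eqP; rewrite -subr_eq0; have := subrr (Pp u).
    rewrite {1}pE -{2}[Pp u]scale1r -scalerBl => /eqP.
    by rewrite scaler_eq0 => /orP[//|/eqP].
have tauq : tau (q n) @[n --> \oo] --> (0 : R).
  exact: (cvg_comp _ _ (cvg_geq_id qn) tau_cvg).
pose d n := t (q n) * tau (q n).
have dh0 : d n *: h @[n --> \oo] --> (0 : E).
  by rewrite -(scale0r h) -(mulr0 1); apply: cvgZl; exact: cvgM.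
have zu : y (q n) - d n *: h @[n --> \oo] --> u.
  by rewrite -[X in _ --> X]subr0; exact: cvgB.
(* y (q n) - d n *: h has E+ part t (q n) *: u+ *)
near \oo => n; have d0 : 0 < d n by rewrite mulr_gt0.
have := decr (y (q n) - d n *: h) (d n) _ d0 _; rewrite subrK.
have Phiz : Phi (y (q n) - d n *: h) <= c.
  rewrite -Phiu; apply: umax; apply/half_spaceP => //; exists (t (q n)) => //.
  by rewrite linearB linearZ/= (proj_Ep Eph) pyE /w scalerDr scalerA addrK.
have ut : `|u - (y (q n) - d n *: h)| < r.
  by near: n; exact: cvgr_dist_lt.
have dr : d n * `|h| < r.
  rewrite -(gtr0_norm d0) -normrZ -normrN -sub0r; near: n.
  exact: cvgr_dist_lt.
move=> /(_ ut dr); have [_ Phiyq] := yP (q n).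
have tq : 0 < t (q n) - 2^-1.
  by rewrite subr_gt0; near: n; apply: (cvgr_gt _ t1); lra.
have tauqm : 0 < m / 2 - tau (q n).
  by rewrite subr_gt0; near: n; apply: (cvgr_lt _ tauq); rewrite divr_gt0.
have := mulr_gt0 (tau0 (q n)) tauqm; have := mulr_gt0 (mulr_gt0 m0 (tau0 (q n))) tq.
rewrite /d; lra.
Unshelve. all: by end_near. Qed.

(** * The Nehari-Pankov set *)

Context (S1 : forall w : E, Ep w -> w <> 0 ->
     (forall u v : E,
        half_space E0 Em w u ->
        diff_zero_on Phi u (set_add (set_add (line w) E0) Em) ->
        half_space E0 Em w v ->
        diff_zero_on Phi v (set_add (set_add (line w) E0) Em) -> u = v) /\
     (forall u : E,
        half_space E0 Em w u ->
        diff_zero_on Phi u (set_add (set_add (line w) E0) Em) ->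
        forall v : E, half_space E0 Em w v -> Phi v <= Phi u)).

Lemma half_space_self u : half_space E0 Em (Pp u) u.
Proof. by apply/half_spaceP; [exact: Pp_mem | exists 1; rewrite ?scale1r]. Qed.

Lemma nehari_pankov_diff u : nehari_pankov E0 Em Phi u ->
  diff_zero_on Phi u (set_add (set_add (line (Pp u)) E0) Em).
Proof.
by move=> /nehari_pankovP[_ du] h /(ray_spaceP _ (Pp_mem u))[t ph]; exact: du ph.
Qed.

Lemma nehari_pankov_max u : nehari_pankov E0 Em Phi u ->
  forall v, half_space E0 Em (Pp u) v -> Phi v <= Phi u.
Proof.
move=> NPu; have /nehari_pankovP[pu0 _] := NPu.
exact: (S1 (Pp_mem u) pu0).2 (half_space_self u) (nehari_pankov_diff NPu).
Qed.

Lemma max_nehari_pankov w y : Ep w -> w <> 0 -> half_space E0 Em w y ->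
  (forall v, half_space E0 Em w v -> Phi v <= Phi y) -> nehari_pankov E0 Em Phi y.
Proof.
move=> Epw w0 wy ymax; have dy := maximizer_diff Epw wy ymax.
have /(half_spaceP _ Epw)[s s0 py] := wy; apply/nehari_pankovP.
split=> [|h t]; first by rewrite py => /eqP; rewrite scaler_eq0 gt_eqF//= => /eqP.
by rewrite py scalerA; exact: dy.
Qed.

Lemma nehari_pankov_max_unique u v : nehari_pankov E0 Em Phi u ->
  half_space E0 Em (Pp u) v ->
  (forall z, half_space E0 Em (Pp u) z -> Phi z <= Phi v) -> v = u.
Proof.
move=> NPu uv vmax; have /nehari_pankovP[pu0 _] := NPu.
have dv := maximizer_diff (Pp_mem u) uv vmax.
apply: (S1 (Pp_mem u) pu0).1 uv _ (half_space_self u) (nehari_pankov_diff NPu).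
by move=> h /(ray_spaceP _ (Pp_mem u))[t]; exact: dv.
Qed.

(** The two hypotheses say that c is the infimum over w of the suprema of Phi on E_w,
    without presupposing that these suprema are finite. *)
Theorem nehari_pankov_minimax c :
  (forall w e, Ep w -> w <> 0 -> 0 < e ->
     exists2 v, half_space E0 Em w v & c - e < Phi v) ->
  (forall e, 0 < e -> exists w, [/\ Ep w, w <> 0 &
     forall v, half_space E0 Em w v -> Phi v <= c + e]) ->
  [/\ 0 < c, exists2 y, nehari_pankov E0 Em Phi y & Phi y = c,
      forall u, nehari_pankov E0 Em Phi u -> c <= Phi u &
      forall u, nehari_pankov E0 Em Phi u -> Phi u = c -> critical Phi u].
Proof.
move=> clow cup; have [w [y [[Epw w0 wy Phiy wc] c0]]] := minimal_ray_attained clow cup.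
split=> //.
- by exists y => //; apply: max_nehari_pankov wy _ => //; rewrite Phiy.
- move=> u NPu; have /nehari_pankovP[pu0 _] := NPu.
  apply/ler_addgt0Pr => e e0; have [v uv cv] := clow _ _ (Pp_mem u) pu0 e0.
  by have := nehari_pankov_max NPu uv; lra.
- move=> u NPu Phiu; have /nehari_pankovP[pu0 du] := NPu.
  apply: (minimizer_critical c0 clow Phiu pu0).
  + by move=> h ph; apply: (du h 0); rewrite scale0r.
  + exact: nehari_pankov_max.
  + by move=> v uv; exact: (nehari_pankov_max_unique NPu uv).
Qed.

End LinkingGeometry.

(** * Ground states *)

Theorem theorem2p1 (R : realType) (E : completeNormedModType R)
  (Ep E0 Em : set E) (Pp P0 Pm : {linear E -> E}) (I Phi : E -> R)
  (E_reflexive : reflexive_space E)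
  (E1_decomposition : topological_decomposition Ep E0 Em Pp P0 Pm)
  (E1_norm : forall u : E,
     `|u| ^+ 2 = `|Pp u| ^+ 2 + `|Pm u| ^+ 2 + `|P0 u| ^+ 2)
  (E1_C1 : C1_on (set_add Ep Em) (fun u : E => `|u| ^+ 2))
  (E2 : uniformly_convex Em)
  (PhiE : forall u : E,
     Phi u = 2^-1 * `|Pp u| ^+ 2 - 2^-1 * `|Pm u| ^+ 2 - I u)
  (Phi_C1 : C1 Phi)
  (I0_C1 : C1 I)
  (I0_ge0 : forall u : E, 0 <= I u)
  (I0_0 : I 0 = 0)
  (I0_diff0 : critical I 0)
  (I0_gt0 : forall u : E, E0 u -> u <> 0 -> 0 < I u)
  (I0_mono : forall u : E, u <> 0 -> forall s t : R, 0 < s -> s <= t ->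
     I (s *: u) / s ^+ 2 <= I (t *: u) / t ^+ 2)
  (I0_limsup : forall u : E, u <> 0 ->
     (limf_esup (fun t : R => (I (t *: u) / t ^+ 2)%:E) (0 : R)^'+
        < (`|u| ^+ 2 / 2)%:E)%E)
  (I0_lim : forall u : E, u <> 0 -> I u <> 0 -> Pp u <> 0 ->
     I (t *: u) / t ^+ 2 @[t --> +oo] --> +oo)
  (I1 : forall eps : R, 0 < eps -> exists2 kappa : R, 0 < kappa &
     forall phi psi : E, I (phi + psi) <= eps + kappa * (I phi + I psi))
  (I2 : forall (u : E) (w_ : nat -> E) (w : E),
     (forall n, Ep (w_ n)) -> Ep w -> weak_cvg Ep w_ w ->
     I (u + w_ n) @[n --> \oo] --> I (u + w))
  (I3 : forall (u_ : nat -> E) (u : E),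
     weak_cvg setT u_ u -> Pp (u_ n) @[n --> \oo] --> Pp u ->
     ((I u)%:E <= limn_einf (fun n => (I (u_ n))%:E))%E /\
     (Pm (u_ n) @[n --> \oo] --> Pm u ->
      (I u)%:E = limn_einf (fun n => (I (u_ n))%:E) ->
      exists2 k : nat -> nat, {homo k : m n / (m < n)%N} &
        P0 (u_ (k n)) @[n --> \oo] --> P0 u))
  (S1 : forall w : E, Ep w -> w <> 0 ->
     (forall u v : E,
        half_space E0 Em w u ->
        diff_zero_on Phi u (set_add (set_add (line w) E0) Em) ->
        half_space E0 Em w v ->
        diff_zero_on Phi v (set_add (set_add (line w) E0) Em) -> u = v) /\
     (forall u : E,
        half_space E0 Em w u ->
        diff_zero_on Phi u (set_add (set_add (line w) E0) Em) ->
        forall v : E, half_space E0 Em w v -> Phi v <= Phi u))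
  (S2 : exists w : E, [/\ Ep w, w <> 0 &
     (ereal_sup [set (Phi u)%:E | u in half_space E0 Em w] < +oo)%E]) :
  let NP := nehari_pankov E0 Em Phi in
  let c := ereal_inf [set (Phi u)%:E | u in NP] in
  (NP !=set0 /\ (forall u : E, u <> 0 -> critical Phi u -> NP u)) /\
  [/\ c = ereal_inf
        [set ereal_sup [set (Phi u)%:E | u in half_space E0 Em w]
           | w in [set w : E | Ep w /\ w <> 0]],
      (0 < c)%E,
      (exists u : E, NP u /\ (Phi u)%:E = c),
      (forall u : E, NP u -> (forall v : E, NP v -> Phi u <= Phi v) ->
         critical Phi u)
    & (exists u : E, [/\ u <> 0, critical Phi u &
         forall v : E, v <> 0 -> critical Phi v -> Phi u <= Phi v])].
Proof.
move=> NP c.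
pose csup w := ereal_sup [set (Phi u)%:E | u in half_space E0 Em w].
pose C := ereal_inf [set csup w | w in [set w | Ep w /\ w <> 0]].
have csup_ub w v : half_space E0 Em w v -> ((Phi v)%:E <= csup w)%E.
  by move=> wv; apply: ereal_sup_ubound; exists v.
have C_fin : C \is a fin_num.
  rewrite ge0_fin_numE; last first.
    apply: le_ereal_inf_tmp => _ [w [Epw w0] <-].
    have [v wv Phiv] := Phi_pos_on_ray E1_decomposition PhiE I0_limsup Epw w0.
    by apply: le_trans (csup_ub _ _ wv); rewrite lee_fin ltW.
  have [w [Epw w0 wfin]] := S2; apply: le_lt_trans wfin.
  by apply: ereal_inf_lbound; exists w.
have CE : C = (fine C)%:E by rewrite fineK.
have [|e e0|c0 [y NPy Phiy] c_le c_crit] :=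
  @nehari_pankov_minimax R E Ep E0 Em Pp P0 Pm I Phi E_reflexive E1_decomposition
    E2 PhiE Phi_C1 I0_ge0 I0_0 I0_gt0 I0_mono I0_limsup I0_lim I1 I2 I3 S1 (fine C).
- move=> w e Epw w0 e0.
  have : ((fine C - e)%:E < csup w)%E.
    apply: (@lt_le_trans _ _ C); first by rewrite CE lte_fin/= ltrBlDr ltrDl.
    by apply: ereal_inf_lbound; exists w.
  by move=> /ereal_sup_gt[_ [v wv <-]]; rewrite lte_fin; exists v.
- have : (C < (fine C + e)%:E)%E by rewrite {1}CE lte_fin ltrDl.
  move=> /ereal_inf_lt[_ [w [Epw w0] <-] wC]; exists w; split=> // v wv.
  by rewrite -lee_fin (le_trans (csup_ub _ _ wv))// ltW.
have cE : c = (fine C)%:E.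
  apply/eqP; rewrite eq_le; apply/andP; split.
    by apply: ereal_inf_lbound; exists y => //; rewrite Phiy.
  by apply: le_ereal_inf_tmp => _ [u NPu <-]; rewrite lee_fin c_le.
have NP_crit u : u <> 0 -> critical Phi u -> NP u.
  exact: (critical_nehari_pankov E1_decomposition PhiE Phi_C1 I0_ge0 I0_gt0 I0_mono).
have NP_min_crit u : NP u -> (forall v, NP v -> Phi u <= Phi v) -> critical Phi u.
  move=> NPu umin; apply: c_crit => //; apply/eqP.
  by rewrite eq_le c_le// -Phiy umin.
split; first by split=> //; exists y.
split.
- by rewrite cE -CE.
- by rewrite cE lte_fin.
- by exists y; rewrite cE Phiy.
- exact: NP_min_crit.
- exists y; split.
  + move=> y0; have /(nehari_pankovP _ E1_decomposition)[] := NPy.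
    by rewrite y0 linear0.
  + exact: c_crit.
  + by move=> v v0 /(NP_crit _ v0) NPv; rewrite Phiy c_le.
Qed.
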